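(* For every integer $d \geq 2$ there exists a $d$-regular measurably bipartite treeing $T$ that admits no measurable perfect matching. Moreover, every measurable circulation in $L^{as}_1(E(T))$ is zero almost everywhere.
   Context: A graphing is a probability measure preserving (pmp) Borel graph: a Borel graph $G$ on a standard probability space $(V(G),\nu)$ such that for all measurable $A,B\subseteq V(G)$ one has $\int_A \deg_B(x)\,d\nu(x)=\int_B \deg_A(x)\,d\nu(x)$, where $\deg_B(x)$ is the number of neighbours of $x$ in $B$. A treeing is an essentially acyclic graphing, i.e. the set of vertices whose connected component contains a cycle is a $\nu$-nullset. A graphing is measurably bipartite if its vertex set admits a partition into two measurable sets $A,B$ such that every edge joins $A$ and $B$. A measurable perfect matching is a measurable set of edges $M$ such that every vertex is incident to exactly one edge of $M$. The vertex measure $\nu$ induces a measure $\mu$ on Borel sets $S$ of edges (or of directed edges supported on adjacent pairs) by $\mu(S)=\frac12\int_{V(G)}\deg_S(x)\,d\nu(x)$, where $\deg_S(x)$ is the number of edges of $S$ at $x$ (for directed edges: half the number of edges of $S$ from $x$ plus to $x$). $L^{as}_1(E(G))$ denotes the space of $\mu$-absolutely integrable measurable functions $\phi:V(G)\times V(G)\to\mathbb{R}$ supported on adjacent pairs that are antisymmetric, $\phi(x,y)=-\phi(y,x)$. Such a $\phi$ is a circulation if $\sum_{y}\phi(x,y)=0$ for every vertex $x$. *)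

(* Defs.v *)
From HB Require Import structures.
From mathcomp Require Import all_boot all_order all_algebra.
From mathcomp Require Import all_classical all_reals all_analysis.
From mathcomp Require Import measurable_realfun.

Set Implicit Arguments.
Unset Strict Implicit.
Unset Printing Implicit Defensive.

Import Order.TTheory GRing.Theory Num.Theory.
Import numFieldNormedType.Exports.

Local Open Scope classical_set_scope.
Local Open Scope ring_scope.

(* V is Borel isomorphic, through f, to a Borel subset of a Polish space X.
   A complete pseudometric structure is a complete metric once X is Hausdorff.
   Since the range of f is Borel, its Borel subsets are its traces of Borel
   sets of X. *)
Definition standard_borel (R : realType) (disp : measure_display)
    (V : measurableType disp) : Prop :=
  exists (X : completePseudoMetricType R) (f : V -> X),
    [/\ hausdorff_space X,
        exists D : set X, countable D /\ dense D,
        injective f,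
        <<s open >> (range f) &
        forall A : set V, measurable A <-> <<s open >> (f @` A)].

Section Graphings.
Context (R : realType) (disp : measure_display) (V : measurableType disp).
Implicit Types (nu : probability V R) (E M : set (V * V)) (A B : set V).

(* A graph on V is given by its set E of adjacent (ordered) pairs. *)
Definition simple_graph E : Prop :=
  (forall x, ~ E (x, x)) /\ (forall x y, E (x, y) -> E (y, x)).

Definition deg E B (x : V) : \bar R := counting (xsection E x `&` B).

Definition regular (d : nat) E : Prop :=
  forall x, deg E setT x = d%:R%:E.

Definition graphing nu E : Prop :=
  [/\ measurable E, simple_graph E &
      forall A B, measurable A -> measurable B ->
        (\int[nu]_(x in A) deg E B x = \int[nu]_(x in B) deg E A x)%E].

Definition adj E : rel V := fun x y => `[< E (x, y) >].

Definition component_has_cycle E (x : V) : Prop :=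
  exists p c : seq V, [/\ path (adj E) x p, last x p \in c,
    (3 <= size c)%N & ucycle (adj E) c].

Definition treeing nu E : Prop :=
  graphing nu E /\ nu.-negligible [set x | component_has_cycle E x].

Definition measurably_bipartite E : Prop :=
  exists A B, [/\ measurable A, measurable B, A `|` B = setT, A `&` B = set0 &
    forall x y, E (x, y) -> (A x /\ B y) \/ (B x /\ A y)].

(* For a symmetric S (a set of undirected edges) the two summands coincide and
   dir_deg S x is the number of edges of S at x. *)
Definition dir_deg (S : set (V * V)) (x : V) : \bar R :=
  ((2^-1)%:E * (counting (xsection S x) + counting (ysection S x)))%E.

Definition edge_measure nu E (S : set (V * V)) : \bar R :=
  ((2^-1)%:E * \int[nu]_x dir_deg (S `&` E) x)%E.

(* Measurability of a set of edges is taken with respect to the completion of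
   the edge measure: with Borel sets only, requiring the matching condition at
   every vertex would let a null set of vertices obstruct a matching. *)
Definition measurable_perfect_matching nu E M : Prop :=
  [/\ completed_algebra_gen (edge_measure nu E) M,
      M `<=` E,
      forall x y, M (x, y) -> M (y, x) &
      forall x, exists! y, M (x, y)].

(* The first clause is measurability with respect to the completion of the edge
   measure together with absolute integrability. *)
Definition L1as nu E (phi : V * V -> R) : Prop :=
  [/\ exists2 g : V * V -> R,
        (edge_measure nu E).-integrable setT (EFin \o g) &
        (edge_measure nu E).-negligible [set e | phi e != g e],
      forall x y, ~ E (x, y) -> phi (x, y) = 0 &
      forall x y, phi (x, y) = - phi (y, x)].

(* The sum ranges over the finite support of phi (x, -). *)
Definition circulation (phi : V * V -> R) : Prop :=
  forall x, \sum_(y \in [set: V]) phi (x, y) = 0.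

End Graphings.

(* Main.v *)
Require Import Defs.
From HB Require Import structures.
From mathcomp Require Import all_boot all_order all_algebra finmap.
From mathcomp Require Import all_classical all_reals all_analysis.
From mathcomp Require Import measurable_realfun zify ring lra.

(* The treeing is a limit of finite d-regular bipartite multigraphs G_n.  Let A
   and B be the two sides and let H be a set of edges of G_n.  G_(n+1) is made
   of d copies of a truncated Z-cover of G_n with levels 0, ..., K: an edge of H
   raises the level by 1 from A to B, the other edges keep it.  The edges missing
   at the two ends are replaced by edges lying over edges of G_n, in such a way
   that G_(n+1) is d-regular and that all edges of G_n have equally many lifts.
   The level, corrected at the ends, is a bounded function on the vertices of
   G_(n+1) whose coboundary takes values in [0, 1] and equals the indicator of H
   away from the ends.  With K = 2^n almost every point avoids the ends from some
   n on, so that its d labelled neighbours are defined.  H runs infinitely often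
   through all the sets "A-end in a given cylinder, given label".
   - If H contains exactly one edge of a cycle (or of a double edge), the level
     changes by 1 along this edge only, which is absurd: the limit is simple and
     acyclic.
   - An integrable circulation is orthogonal to all coboundaries of bounded
     functions by mass transport, hence by dominated convergence to the indicators
     of all these sets H, so it vanishes almost everywhere.
   - A perfect matching M would give the circulation d 1_M - 1 (from A to B). *)

Set Implicit Arguments.
Unset Strict Implicit.
Unset Printing Implicit Defensive.

Import Order.TTheory GRing.Theory Num.Theory.
Import numFieldNormedType.Exports.

Local Open Scope classical_set_scope.
Local Open Scope nat_scope.

(** * One refinement step: truncated covers of finite labelled multigraphs *)

Section Refinement.
Variables (d K : nat).

(* [child v z i] is the [i]-th copy of [v] at level [z], counted from 0 to [K] on
   one side of the bipartition and from [K] to 0 on the other side. *)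
Definition child (v z i : nat) : nat := v * (K.+1 * d) + (z * d + i).
Definition parent (x : nat) : nat := x %/ (K.+1 * d).
Definition level (x : nat) : nat := x %% (K.+1 * d) %/ d.
Definition copy (x : nat) : nat := x %% d.

Hypothesis d_gt0 : 0 < d.

Lemma level_le x : level x <= K.
Proof. by rewrite -ltnS /level ltn_divLR // ltn_mod muln_gt0 d_gt0. Qed.

Lemma copy_lt x : copy x < d.
Proof. by rewrite ltn_mod. Qed.

Lemma parent_child v z i : z <= K -> i < d -> parent (child v z i) = v.
Proof.
move=> zK id; rewrite /parent /child divnMDl ?muln_gt0 ?d_gt0 // divn_small ?addn0 //.
nia.
Qed.

Lemma level_child v z i : z <= K -> i < d -> level (child v z i) = z.
Proof.
move=> zK id; rewrite /level /child modnMDl modn_small; last by nia.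
by rewrite divnMDl // divn_small ?addn0.
Qed.

Lemma copy_child v z i : i < d -> copy (child v z i) = i.
Proof. by move=> id; rewrite /copy /child mulnA addnA -mulnDl modnMDl modn_small. Qed.

Lemma childK x : child (parent x) (level x) (copy x) = x.
Proof.
rewrite /child /parent /level /copy [RHS](divn_eq x (K.+1 * d)); congr (_ + _).
rewrite [RHS](divn_eq _ d); congr (_ + _).
by rewrite modn_dvdm // dvdn_mull.
Qed.

Lemma child_lt v z i M : v < M -> z <= K -> i < d -> child v z i < M * (K.+1 * d).
Proof. by rewrite /child; nia. Qed.

Lemma parent_lt x M : x < M * (K.+1 * d) -> parent x < M.
Proof. by rewrite /parent ltn_divLR // muln_gt0 d_gt0. Qed.

Lemma leq_parent x M : (M <= parent x) = (M * (K.+1 * d) <= x).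
Proof. by rewrite /parent leq_divRL // muln_gt0 d_gt0. Qed.

Variables (phi : nat * nat -> nat * nat) (H : pred (nat * nat)).

(* [phi] exchanges the two ends (vertex, label) of each edge, and [H] is a set of
   edges.  Copies and labels share the index set {0, ..., d-1}: at level [K], the
   copies [i] of [v] with [H (v, i)] leave the cover, and each of them is joined by
   [d] parallel edges to a copy leaving at the other end of the edge [(v, i)].  For
   the remaining copies [i] the missing edges, with labels [r] such that
   [H (v, r)], are replaced by exchanging the roles of [r] and [i].  As levels are
   counted in opposite directions on the two sides, a single rule covers both ends
   of the cover and defines an involution. *)
Definition step (v z i r : nat) : nat * nat * nat * nat :=
  let: (w, s) := phi (v, r) in
  let: (u, j) := phi (v, i) in
  if z == K then
    if H (v, i) then (u, K, j, r)
    else if H (v, r) then (u, 0, r, j)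
    else (w, 0, i, s)
  else if H (v, r) then (w, K - z.+1, i, s)
  else if (z == 0) && H (w, i) then (w, K, s, i)
  else (w, K - z, i, s).

Definition refine (p : nat * nat) : nat * nat :=
  let: (w, z, i, s) := step (parent p.1) (level p.1) (copy p.1) p.2 in
  (child w z i, s).

(* The values on the copies which leave the cover make [height] increase by exactly
   1 along the parallel edges, which lie over edges of [H]. *)
Definition height (side : bool) (x : nat) : nat :=
  let extra := (level x == K) && H (parent x, copy x) in
  if side then (if extra then 1 else K - level x)
  else (if extra then 0 else level x).

Variable M : nat.
Hypothesis K_gt0 : 0 < K.
Hypothesis phi_dom : forall v r, v < M.*2 -> r < d ->
  [/\ (phi (v, r)).1 < M.*2, (phi (v, r)).2 < d,
      phi (phi (v, r)) = (v, r) & ((phi (v, r)).1 < M) = ~~ (v < M)].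
Hypothesis H_phi : forall v r, v < M.*2 -> r < d -> H (phi (v, r)) = H (v, r).

(** Each branch of [step] is undone by a branch of [step]: parallel edges and ordinary lifts by
    their own kind, the two exchanging branches by each other. The last clause records that even an
    exchanged edge lies over an edge of the base graph, possibly with another label. *)
Lemma step_dom v z i r : v < M.*2 -> z <= K -> i < d -> r < d ->
  let: (w, y, j, s) := step v z i r in
  [/\ [/\ w < M.*2, y <= K, j < d & s < d],
      step w y j s = (v, z, i, r), (w < M) = ~~ (v < M) &
      exists2 t, t < d & (phi (v, t)).1 = w].
Proof.
move=> vM zK id rd; rewrite /step.
have [] := phi_dom vM rd; have := H_phi vM rd.
have [] := phi_dom vM id; have := H_phi vM id.
case Ei: (phi (v, i)) => [u j]; case Er: (phi (v, r)) => [w s] /=.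
move=> Hi uM jd phij uside Hr wM sd phis wside.
have [->|zneK] := eqVneq z K.
  have [Hvi|nHvi] := boolP (H (v, i)).
    split; rewrite ?eqxx //; last by exists i => //; rewrite Ei.
    by case: (phi (u, r)) => ? ?; rewrite phij Hi Hvi.
  have [Hvr|nHvr] := boolP (H (v, r)).
    split; rewrite ?eqxx //; last by exists i => //; rewrite Ei.
    rewrite phij Hi (negbTE nHvi) Hvr /=.
    by case: (phi (u, r)) => ? ?; rewrite eq_sym (gtn_eqF K_gt0).
  split; rewrite ?eqxx //; last by exists r => //; rewrite Er.
  rewrite phis Hr (negbTE nHvi) (negbTE nHvr) /= subn0.
  by case: (phi (w, i)) => ? ?; rewrite eq_sym (gtn_eqF K_gt0).
have zltK : z < K by rewrite ltn_neqAle zneK.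
have [Hvr|nHvr] := boolP (H (v, r)).
  split; rewrite ?leq_subr //; last by exists r => //; rewrite Er.
  rewrite phis Hr Hvr; case: (phi (w, i)) => ? ?.
  by rewrite (_ : _ == K = false); [congr (_, _, _, _); lia | apply/eqP; lia].
have [/andP[/eqP z0 Hwi]|] := boolP ((z == 0) && _).
  split; rewrite ?leqnn //; last by exists r => //; rewrite Er.
  have := H_phi wM id; have [] := phi_dom wM id.
  rewrite phis; case: (phi (w, i)) => ? ? /= _ _ _ _ _.
  by rewrite eqxx Hr (negbTE nHvr) Hwi z0.
move=> ncond; split; rewrite ?leq_subr //; last by exists r => //; rewrite Er.
rewrite phis Hr (negbTE nHvr) subKn //.
case: (phi (w, i)) => ? ?.
have [z0|zn0] := eqVneq z 0.
  rewrite z0 subn0 eqxx; move: ncond; rewrite z0 eqxx /= => /negbTE ->.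
  by [].
rewrite (_ : (K - z == K) = false); last by apply/eqP; lia.
by rewrite (_ : (K - z == 0) = false) //; apply/eqP; lia.
Qed.

Lemma step_inner v z i r : 0 < z < K ->
  step v z i r = ((phi (v, r)).1, K - z - H (v, r), i, (phi (v, r)).2).
Proof.
move=> /andP[z0 zK]; rewrite /step; case: (phi (v, r)) => w s /=.
case: (phi (v, i)) => u j; rewrite (ltn_eqF zK) (gtn_eqF z0) /=.
by case: (H _); rewrite ?subn0 // subnS subn1.
Qed.

Lemma refine_dom x r : x < (M * (K.+1 * d)).*2 -> r < d ->
  [/\ (refine (x, r)).1 < (M * (K.+1 * d)).*2, (refine (x, r)).2 < d,
      refine (refine (x, r)) = (x, r) &
      ((refine (x, r)).1 < M * (K.+1 * d)) = ~~ (x < M * (K.+1 * d))].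
Proof.
rewrite doubleMl => xM rd; rewrite /refine /=.
have := step_dom (parent_lt xM) (level_le x) (copy_lt x) rd.
case: (step _ _ _ _) => [[[w y] j] s] [[wM yK jd sd] inv side _] /=.
split => //; first exact: child_lt.
  by rewrite (parent_child w yK jd) (level_child w yK jd) (copy_child w y jd) inv childK.
move: side; rewrite -{1}(parent_child w yK jd) !ltnNge !leq_parent.
by [].
Qed.

Lemma refine_parent x r : x < (M * (K.+1 * d)).*2 -> r < d ->
  exists2 t, t < d & (phi (parent x, t)).1 = parent (refine (x, r)).1.
Proof.
rewrite doubleMl => xM rd; rewrite /refine /=.
have := step_dom (parent_lt xM) (level_le x) (copy_lt x) rd.
case: (step _ _ _ _) => [[[w y] j] s] [[wM yK jd sd] inv side [t td tw]] /=.
by exists t; rewrite // (parent_child w yK jd).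
Qed.

Lemma refine_inner x r : x < (M * (K.+1 * d)).*2 -> r < d -> 0 < level x < K ->
  [/\ parent (refine (x, r)).1 = (phi (parent x, r)).1,
      (refine (x, r)).2 = (phi (parent x, r)).2 &
      level (refine (x, r)).1 = K - level x - H (parent x, r)].
Proof.
rewrite doubleMl => xM rd lx; rewrite /refine /= step_inner //=.
have lK : K - level x - H (parent x, r) <= K by rewrite -subnDA leq_subr.
by rewrite parent_child ?copy_lt // level_child ?copy_lt.
Qed.

(** The increase is 1 on the lifts of [H] and on the parallel edges. It is 0 on all other edges; in
    particular the exchanged edges stay at the extreme level where they start. *)
Lemma height_refine x r : x < M * (K.+1 * d) -> r < d ->
  height false x <= height true (refine (x, r)).1 <= (height false x).+1.
Proof.
move=> xM rd; rewrite /refine /=.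
have vM : parent x < M.*2 by apply: leq_trans (parent_lt xM) _; rewrite -addnn leq_addr.
have zK := level_le x; have id := copy_lt x.
rewrite /height /step.
move: zK id vM; set v := parent x; set z := level x; set i := copy x => zK id vM.
have [] := phi_dom vM rd; have := H_phi vM rd.
have [] := phi_dom vM id; have := H_phi vM id.
case Ei: (phi (v, i)) => [u j]; case Er: (phi (v, r)) => [w s] /=.
move=> Hi uM jd phij uside Hr wM sd phis wside.
have KN0 : (0 == K) = false by rewrite eq_sym (gtn_eqF K_gt0).
have [->|zneK] := eqVneq z K.
  have [Hvi|nHvi] := boolP (H (v, i)).
    by rewrite /= level_child // parent_child // copy_child // eqxx Hi Hvi.
  have [Hvr|nHvr] := boolP (H (v, r)).
    by rewrite /= level_child // KN0 /= subn0 leqnn leqnSn.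
  by rewrite /= level_child // KN0 /= subn0 leqnn leqnSn.
have zltK : z < K by rewrite ltn_neqAle zneK.
have [Hvr|nHvr] := boolP (H (v, r)).
  rewrite /= level_child // ?leq_subr // (_ : _ == K = false) /=; last by apply/eqP; lia.
  by apply/andP; split; lia.
have [/andP[/eqP z0 Hwi]|ncond] := boolP ((z == 0) && _).
  rewrite /= level_child // parent_child // copy_child //.
  by rewrite Hr (negbTE nHvr) andbF z0 subnn.
rewrite /= level_child ?leq_subr // parent_child ?leq_subr // copy_child //.
have [z0|zn0] := eqVneq z 0.
  by move: ncond; rewrite z0 /= => /negbTE ->; rewrite andbF subn0 subnn.
rewrite (_ : (K - z == K) = false) /=; last by apply/eqP; lia.
by rewrite subKn // leqnn leqnSn.
Qed.

End Refinement.

(** * The tower of finite multigraphs *)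

Section Tower.
Variable d : nat.

(** The covers lengthen so fast that the proportions of vertices near their ends are summable, as
    Borel-Cantelli requires. *)
Definition top (n : nat) : nat := 2 ^ n.
Definition fanout (n : nat) : nat := (top n).+1 * d.
Definition width (n : nat) : nat := \prod_(i < n) fanout i.
Definition ancestor (m n v : nat) : nat := v %/ \prod_(m <= i < n) fanout i.

(* The 2-adic valuation makes every value of [code] recur infinitely often. *)
Definition code (n : nat) : nat * nat * nat :=
  odflt (0, 0, 0) (choice.unpickle (logn 2 n.+1)).

Lemma code_unbounded (c : nat * nat * nat) (n0 : nat) :
  exists2 n, n0 <= n & code n = c.
Proof.
have gt0 : 0 < 2 ^ choice.pickle c * n0.*2.+1 by rewrite muln_gt0 expn_gt0.
(* The odd factor [n0.*2.+1] leaves the valuation equal to [choice.pickle c] and pushes the index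
   beyond [n0]. *)
exists (2 ^ choice.pickle c * n0.*2.+1).-1.
  rewrite -ltnS prednK //; apply: (@leq_trans n0.*2.+1).
    by rewrite ltnS -addnn leq_addr.
  by rewrite leq_pmull // expn_gt0.
rewrite /code prednK // lognM ?expn_gt0 // pfactorK //.
rewrite [X in _ + X](_ : _ = 0) ?addn0 ?choice.pickleK //.
by apply/eqP; rewrite -[_ == 0]negbK -lt0n logn_gt0 mem_primes /= dvdn2 /= odd_double.
Qed.

(* Vertices of level [n] are numbered from 0 to [2 * width n - 1], and those below
   [width n] form the side A. *)
Definition selected (n : nat) (p : nat * nat) : bool :=
  let: (m, a, r) := code n in
  [&& p.1 < width n, m <= n, ancestor m n p.1 == a & p.2 == r].

(** Selection only looks at A-ends; closing it under [f] gives a set of undirected edges, as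
    [refine] expects. *)
Definition marked (f : nat * nat -> nat * nat) (n : nat) (p : nat * nat) : bool :=
  selected n p || selected n (f p).

(** The tower starts from two vertices, 0 on side A and 1 on side B, joined by [d] parallel
    edges. *)
Fixpoint mate (n : nat) : nat * nat -> nat * nat :=
  if n is n'.+1 then refine d (top n') (mate n') (marked (mate n') n')
  else fun p => (1 - p.1, p.2).

(* The levels of [y] move away from both ends of the successive covers. *)
Definition spread (y : nat -> nat) : Prop :=
  forall k, exists n0, forall n, n0 <= n ->
    k <= level d (top n) (y n.+1) /\ level d (top n) (y n.+1) + k <= top n.

Hypothesis d_gt0 : 0 < d.

Lemma top_gt0 n : 0 < top n. Proof. by rewrite expn_gt0. Qed.

Lemma fanout_gt0 n : 0 < fanout n. Proof. by rewrite muln_gt0. Qed.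

Lemma widthS n : width n.+1 = width n * fanout n.
Proof. by rewrite /width big_ord_recr. Qed.

Lemma width_gt0 n : 0 < width n.
Proof. by rewrite prodn_gt0 // => i; exact: fanout_gt0. Qed.

Lemma width_ge n : 2 ^ n <= width n.
Proof.
elim: n => [|n IHn]; first by rewrite /width big_ord0.
rewrite widthS expnS mulnC leq_mul // /fanout -[2]muln1 leq_mul //.
by rewrite ltnS top_gt0.
Qed.

Lemma mate_dom n v r : v < (width n).*2 -> r < d ->
  [/\ (mate n (v, r)).1 < (width n).*2, (mate n (v, r)).2 < d,
      mate n (mate n (v, r)) = (v, r) &
      ((mate n (v, r)).1 < width n) = ~~ (v < width n)].
Proof.
elim: n v r => [|n IHn] v r.
  by rewrite /width big_ord0 /=; case: v => [|[|]].
rewrite widthS => vM rd; apply: (refine_dom d_gt0 (top_gt0 n) IHn _ vM rd).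
move=> {vM}v {rd}r vM rd; have [_ _ invo _] := IHn _ _ vM rd.
by rewrite /marked -!/(mate n) invo orbC.
Qed.

Lemma marked_mate n v r : v < (width n).*2 -> r < d ->
  marked (mate n) n (mate n (v, r)) = marked (mate n) n (v, r).
Proof.
by move=> vM rd; have [_ _ invo _] := mate_dom vM rd; rewrite /marked invo orbC.
Qed.

Lemma mate_parent n x r : x < (width n.+1).*2 -> r < d ->
  exists2 t, t < d &
    (mate n (parent d (top n) x, t)).1 = parent d (top n) (mate n.+1 (x, r)).1.
Proof.
rewrite widthS => xM rd.
exact: (refine_parent d_gt0 (top_gt0 n) (@mate_dom n) (@marked_mate n) xM rd).
Qed.

Lemma mate_inner n x r : x < (width n.+1).*2 -> r < d ->
    0 < level d (top n) x < top n ->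
  [/\ parent d (top n) (mate n.+1 (x, r)).1 = (mate n (parent d (top n) x, r)).1,
      (mate n.+1 (x, r)).2 = (mate n (parent d (top n) x, r)).2 &
      level d (top n) (mate n.+1 (x, r)).1 =
        top n - level d (top n) x - marked (mate n) n (parent d (top n) x, r)].
Proof. by rewrite widthS => xM rd; apply: refine_inner xM rd. Qed.

Lemma height_mate n x r : x < width n.+1 -> r < d ->
  let h := height d (top n) (marked (mate n) n) in
  h false x <= h true (mate n.+1 (x, r)).1 <= (h false x).+1.
Proof.
rewrite widthS => xM rd.
exact: (height_refine d_gt0 (top_gt0 n) (@mate_dom n) (@marked_mate n) xM rd).
Qed.

End Tower.

(** The interface between combinatorics and measure: the points correspond to the coherent vertex
    sequences that stay away from the ends. Coherence is only asked from some index on in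
    [coord_limit], because the neighbours of a point in the finite graphs become coherent only
    eventually. *)
Record coordinate_system (d : nat) (V : Type) (D : nat -> V -> nat) : Prop :=
  CoordinateSystem {
    label_gt0 : 0 < d;
    coord_lt : forall n x, D n x < (width d n).*2;
    coord_parent : forall n x, parent d (top n) (D n.+1 x) = D n x;
    coord_inj : forall x y, (\forall n \near \oo, D n x = D n y) -> x = y;
    coord_spread : forall x, spread d (D ^~ x);
    coord_limit : forall (y : nat -> nat) n0,
      (forall n, n0 <= n -> parent d (top n) (y n.+1) = y n) ->
      (forall n, n0 <= n -> y n < (width d n).*2) -> spread d y ->
      exists x, \forall n \near \oo, D n x = y n }.

(** * The limit graph: neighbours, simplicity, acyclicity *)

Section LimitGraph.
Context (d : nat) (disp : measure_display) (V : measurableType disp) (D : nat -> V -> nat).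
Hypothesis DP : coordinate_system d D.
Let d_gt0 := label_gt0 DP.
Let D_lt := coord_lt DP.
Let D_parent := coord_parent DP.
Let D_inj := coord_inj DP.
Let D_spread := coord_spread DP.
Let D_limit := coord_limit DP.

(** Only late indices count: at finitely many stages a point may lie near an end of the cover, where
    edges are exchanged. *)
Definition linked (x : V) (r : nat) (y : V) (s : nat) : Prop :=
  \forall n \near \oo, mate d n (D n x, r) = (D n y, s).

Lemma linked_dom x r y s : r < d -> linked x r y s -> s < d.
Proof.
move=> rd [n _ /(_ n (leqnn n)) e].
by have [_ + _ _] := mate_dom d_gt0 (D_lt n x) rd; rewrite e.
Qed.

Lemma linked_sym x r y s : r < d -> linked x r y s -> linked y s x r.
Proof.
move=> rd; apply: filterS => n e.
by have [_ _ + _] := mate_dom d_gt0 (D_lt n x) rd; rewrite e.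
Qed.

Lemma linked_fun x r y s y' s' :
  linked x r y s -> linked x r y' s' -> y = y' /\ s = s'.
Proof.
move=> xy xy'; split.
  by apply: D_inj; apply: filterS2 xy xy' => n -> [].
case: xy xy' => [n _ xy] [n' _ xy'].
by have := xy' _ (leq_maxr n n'); rewrite (xy _ (leq_maxl n n')) => -[].
Qed.

(** Once the levels of [x] are away from the ends, the finite neighbours of [x] along [r] form a
    coherent sequence with a constant label at the other end, and [coord_limit] provides the limit
    point. *)
Lemma linked_exists x r : r < d -> exists y s, linked x r y s.
Proof.
move=> rd; have [n0 sp] := D_spread x 2.
pose y n := (mate d n (D n x, r)).1.
pose s n := (mate d n (D n x, r)).2.
have inner n : n0 <= n -> [/\ parent d (top n) (y n.+1) = y n, s n.+1 = s n &
    level d (top n) (y n.+1) =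
      top n - level d (top n) (D n.+1 x) - marked d (mate d n) n (D n x, r)].
  move=> nn; have [lo hi] := sp n nn.
  have [|] := mate_inner d_gt0 (D_lt n.+1 x) rd; first by apply/andP; split; lia.
  by rewrite D_parent.
have [|||z zy] := D_limit (y := y) (n0 := n0).
- by move=> n /inner[].
- by move=> n _; have [] := mate_dom d_gt0 (D_lt n x) rd.
(* A marked edge shifts the level by one, hence the margin [k.+1] at [x] for the margin [k] at its
   neighbour. *)
- move=> k; have [n1 spk] := D_spread x k.+1; exists (maxn n0 n1) => n.
  rewrite geq_max => /andP[/inner[_ _ ->] /spk[lo hi]].
  by case: (marked _ _ _ _); lia.
exists z, (s n0).
have sconst : \forall n \near \oo, s n = s n0.
  exists n0 => // n /= /subnKC <-; elim: (n - n0) => [|k IHk]; first by rewrite addn0.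
  by rewrite addnS; have [_ -> _] := inner _ (leq_addr k n0).
apply: filterS2 zy sconst => n zn sn.
by rewrite zn -sn -surjective_pairing.
Qed.

Definition side (x : V) : bool := 0 < D 0 x.

(** Children stay on the side of their parent, so stage 0 decides. *)
Lemma D_side n x : (D n x < width d n) = ~~ side x.
Proof.
elim: n => [|n IHn]; first by rewrite /width big_ord0 /side; case: (D 0 x).
by rewrite -IHn -(D_parent n x) !ltnNge leq_parent // widthS.
Qed.

Lemma linked_side x r y s : r < d -> linked x r y s -> side y = ~~ side x.
Proof.
move=> rd [n _ /(_ n (leqnn n)) e].
have [_ _ _ +] := mate_dom d_gt0 (D_lt n x) rd.
by rewrite e !D_side /= => /negb_inj.
Qed.

Lemma D_ancestor m n x : m <= n -> ancestor d m n (D n x) = D m x.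
Proof.
rewrite /ancestor => /subnKC <-; elim: (n - m) => [|k IHk].
  by rewrite addn0 big_geq // divn1.
rewrite addnS big_nat_recr ?leq_addr //= mulnC divnMA.
by rewrite -IHk; congr (_ %/ _); exact: D_parent.
Qed.

(** Levels are counted in opposite directions on the two sides; [depth] measures both from the same
    end of the cover. *)
Definition depth (n : nat) (x : V) : nat :=
  if side x then top n - level d (top n) (D n.+1 x) else level d (top n) (D n.+1 x).

(** Eventually [x] is away from the ends, where the cover raises the level exactly along marked
    edges. As [y] is on side B, only the end at [x] can be selected. *)
Lemma linked_depth x r y s m a r0 : r < d -> ~~ side x -> linked x r y s ->
  \forall n \near \oo, code n = (m, a, r0) ->
    depth n y = depth n x + ((D m x == a) && (r == r0)).
Proof.
move=> rd sx xy; have [n0 sp] := D_spread x 2.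
have large : \forall n \near \oo, n0 <= n /\ m <= n.
  by exists (maxn n0 m) => // n /=; rewrite geq_max => /andP.
have xyS : \forall n \near \oo, mate d n.+1 (D n.+1 x, r) = (D n.+1 y, s).
  by case: xy => n1 _ h; exists n1 => // n /= n1n; exact: (h n.+1 (leqW n1n)).
have sy := linked_side rd xy.
apply: filterS3 large xy xyS => n [n0n mn] xyn xySn cn.
have [lo hi] := sp n n0n.
have [|_ _] := mate_inner (x := D n.+1 x) d_gt0 (D_lt _ _) rd.
  by apply/andP; split; lia.
rewrite xySn D_parent /marked /selected cn xyn /= !D_side sy.
rewrite sx mn D_ancestor //= orbF /depth sy (negbTE sx) /= => ->.
by case: (_ && _); lia.
Qed.

(** Double edges are excluded by a late index whose code marks only one of the two labels: the same
    difference of depths would have to be both 1 and 0. *)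
Lemma linked_injective x r y s r' s' : r < d -> r' < d ->
  linked x r y s -> linked x r' y s' -> r = r'.
Proof.
move=> rd r'd.
have base u v t t' q q' : t < d -> t' < d -> ~~ side u ->
    linked u t v q -> linked u t' v q' -> t = t'.
  move=> td t'd su uv uv'.
  have [n1 _ h] := linked_depth 0 (D 0 u) t td su uv.
  have [n2 _ h'] := linked_depth 0 (D 0 u) t t'd su uv'.
  have [n] := code_unbounded (0, D 0 u, t) (maxn n1 n2).
  rewrite geq_max => /andP[n1n n2n] cn.
  have := h' n n2n cn; rewrite (h n n1n cn) !eqxx /= => /addnI.
  by case: eqP => // ->.
move=> xy xy'; have [sx|sx] := boolP (side x); last exact: base xy xy'.
have yx := linked_sym rd xy; have yx' := linked_sym r'd xy'.
have sd := linked_dom rd xy; have s'd := linked_dom r'd xy'.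
have sy : ~~ side y by rewrite (linked_side rd xy) sx.
have e := base _ _ _ _ _ _ sd s'd sy yx yx'; move: yx'; rewrite -e => yx'.
by have [] := linked_fun yx yx'.
Qed.

Definition limit_edges : set (V * V) :=
  [set p | exists r s, r < d /\ linked p.1 r p.2 s].

Lemma limit_edges_simple : simple_graph limit_edges.
Proof.
split => [x [r [s [rd /= xx]]]|x y [r [s [rd /= xy]]]].
  by have := linked_side rd xx; case: (side x).
by exists s, r; split; [exact: linked_dom xy | exact: linked_sym].
Qed.

Lemma limit_edges_side x y : limit_edges (x, y) -> side y = ~~ side x.
Proof. by move=> [r [s [rd /= xy]]]; exact: linked_side xy. Qed.

Lemma D_separates x y : x <> y -> \forall m \near \oo, D m x <> D m y.
Proof.
move=> neq; have [k Dk] : exists k, D k x <> D k y.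
  apply: contrapT => nex; apply: neq; apply: D_inj; exists 0 => // n _.
  by apply: contrapT => Dn; apply: nex; exists n.
by exists k => // m /= km e; apply: Dk; rewrite -!(D_ancestor _ km) e.
Qed.

(** A fine enough cylinder around [p], together with the label [r], isolates the edge from [p] to
    [q] from any other given edge: a different A-end leaves the cylinder, and a different edge at
    [p] has a different label. *)
Lemma edge_depth p r q s u v : r < d -> ~~ side p -> linked p r q s ->
  limit_edges (u, v) -> ~ (u = p /\ v = q) -> ~ (u = q /\ v = p) ->
  \forall m \near \oo, \forall n \near \oo, code n = (m, D m p, r) ->
    depth n u = depth n v.
Proof.
move=> rd sp pq.
have base u' v' : ~~ side u' -> limit_edges (u', v') -> ~ (u' = p /\ v' = q) ->
    \forall m \near \oo, \forall n \near \oo, code n = (m, D m p, r) ->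
      depth n u' = depth n v'.
  move=> su' [t [t' [td /= uv]]] neq.
  have [up|/D_separates] := pselect (u' = p).
    apply: nearW => m.
    apply: filterS (linked_depth m (D m p) r td su' uv) => n /[apply] ->.
    have [tr|] := eqVneq t r; last by rewrite andbF addn0.
    by case: neq; split => //; move: uv; rewrite up tr => /(linked_fun pq) [].
  apply: filterS => m /eqP neqm.
  apply: filterS (linked_depth m (D m p) r td su' uv) => n /[apply] ->.
  by rewrite (negbTE neqm) addn0.
(* If [u] is on side B, the edge is read from its other end. *)
move=> uv n1 n2; have [su|su] := boolP (side u); last exact: base.
have vu := (limit_edges_simple).2 _ _ uv.
have sv : ~~ side v by rewrite (limit_edges_side uv) su.
have := base _ _ sv vu; case/(_ _); first by move=> [vp uq]; apply: n2.
move=> m0 _ h; exists m0 => // m /h; apply: filterS => n /[apply] ->; by [].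
Qed.

Lemma path_depth p r q s u c : r < d -> ~~ side p -> linked p r q s ->
  path (fun v w => adj limit_edges v w &&
    ~~ (((v == p) && (w == q)) || ((v == q) && (w == p)))) u c ->
  \forall m \near \oo, \forall n \near \oo, code n = (m, D m p, r) ->
    depth n u = depth n (last u c).
Proof.
move=> rd sp pq; elim: c u => [|v c IHc] u /=.
  by move=> _; apply: nearW => m; exact: nearW.
case/andP => /andP[/asboolP uv]; rewrite negb_or => /andP[/andP h1 /andP h2] /IHc h.
have := edge_depth rd sp pq uv.
case/(_ _ _); first by move=> [/eqP ? /eqP ?]; exact: h1.
  by move=> [/eqP ? /eqP ?]; exact: h2.
move=> m0 _ g; case: h => m1 _ h.
exists (maxn m0 m1) => // m /=; rewrite geq_max => /andP[/g gm /h hm].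
by apply: filterS2 gm hm => n gn hn cn; rewrite gn // hn.
Qed.

Lemma limit_edges_acyclic (c : seq V) : (3 <= size c)%N -> ~ ucycle (adj limit_edges) c.
Proof.
case: c => [|x0 [|x1 [|x2 c]]] // _ /andP[/= cyc uni].
pose bad v w := ((v == x0) && (w == x1)) || ((v == x1) && (w == x0)).
pose e' v w := adj limit_edges v w && ~~ bad v w.
case/and3P: cyc => e01 e12 pth.
have n01 : x0 != x1 by move: uni; rewrite inE negb_or => /andP[/andP[]].
have n02 : x2 != x0.
  by rewrite eq_sym; move: uni; rewrite !inE !negb_or => /andP[/and3P[]].
have n12 : x2 != x1.
  by rewrite eq_sym; move: uni; rewrite !inE !negb_or => /andP[_ /andP[/andP[]]].
have n0c : x0 \notin c by move: uni; rewrite !inE !negb_or => /andP[/and3P[]].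
have n1c : x1 \notin c.
  by move: uni; rewrite !inE !negb_or => /andP[_ /andP[/andP[]]].
(* The rest of the cycle leads from [x1] back to [x0] and, its vertices being distinct, uses the
   edge between [x0] and [x1] in neither direction. *)
have p' : path e' x1 (x2 :: rcons c x0).
  rewrite /= {1}/e' e12 /bad (negbTE n02) (negbTE n12) !andbF /=.
  move: pth n02 n12 n0c n1c {uni e12}; elim: c x2 => [|x3 c IHc] x2 /=.
    by rewrite !andbT /e' /bad => -> n02 n12 _ _; rewrite (negbTE n02) (negbTE n12).
  case/andP => e23 pth n02 n12; rewrite !inE !negb_or.
  move=> /andP[n03 n0c] /andP[n13 n1c].
  rewrite {1}/e' e23 /bad (negbTE n02) (negbTE n12) /=.
  by apply: IHc; rewrite // eq_sym.
(* At a late index marking this edge but no other edge of the cycle, the depths of its ends are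
   equal by the path and differ by 1 by the edge. *)
have contra p t q z : t < d -> ~~ side p -> linked p t q z ->
    path (fun v w => adj limit_edges v w &&
      ~~ (((v == p) && (w == q)) || ((v == q) && (w == p)))) x1 (x2 :: rcons c x0) ->
    (p = x0 /\ q = x1) \/ (p = x1 /\ q = x0) -> False.
  move=> td sp pq /(path_depth td sp pq) [m _ /(_ m (leqnn m))].
  rewrite /= last_rcons => -[n1 _ h1] ends.
  have [n2 _ h2] := linked_depth m (D m p) t td sp pq.
  have [n] := code_unbounded (m, D m p, t) (maxn n1 n2).
  rewrite geq_max => /andP[/h1 /= h1n /h2 /= h2n] cn.
  have := h2n cn; rewrite !eqxx addn1; have := h1n cn.
  by case: ends => -[-> ->] -> e; exact: (n_Sn _ e).
move/asboolP: e01 => -[r [s [rd /= x01]]].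
have [s0|s0] := boolP (side x0); last by apply: contra rd s0 x01 p' _; left.
have s1 : ~~ side x1 by rewrite (linked_side rd x01) s0.
apply: contra (linked_dom rd x01) s1 (linked_sym rd x01) _ _; last by right.
by move: p'; apply: sub_path => v w; rewrite /e' /bad orbC.
Qed.

(** In contrast to [linked], this holds at every index: adjacency descends from late stages to all
    earlier ones, and only the label may change on the way. *)
Lemma linked_adjacent x r y s : r < d -> linked x r y s ->
  forall n, exists2 t, t < d & (mate d n (D n x, t)).1 = D n y.
Proof.
move=> rd [n0 _ xy] n.
have : exists2 t, t < d & (mate d (n + n0) (D (n + n0) x, t)).1 = D (n + n0) y.
  by exists r => //; rewrite (xy _ (leq_addl n n0)).
elim: n0 {xy} => [|k IHk]; first by rewrite addn0.
rewrite addnS => -[t td e]; apply: IHk.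
have [t' t'd] := mate_parent d_gt0 (D_lt (n + k).+1 x) td.
by rewrite e !D_parent; exists t'.
Qed.

(** This is [depth] corrected near the ends, so that its increments along edges are 0 or 1 at every
    stage. The uniform bound feeds dominated convergence. *)
Definition potential (n : nat) (x : V) : nat :=
  height d (top n) (marked d (mate d n) n) (side x) (D n.+1 x).

Lemma potential_depth x : \forall n \near \oo, potential n x = depth n x.
Proof.
have [n0 sp] := D_spread x 1; exists n0 => // n /= /sp[lo hi].
by rewrite /potential /height /depth ltn_eqF //=; lia.
Qed.

Lemma potential_linked x r y s n : r < d -> ~~ side x -> linked x r y s ->
  potential n x <= potential n y <= (potential n x).+1.
Proof.
move=> rd sx xy; have [t td e] := linked_adjacent rd xy n.+1.
rewrite /potential (linked_side rd xy) (negbTE sx) -e.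
have xw : D n.+1 x < width d n.+1 by rewrite D_side sx.
by have := height_mate d_gt0 xw td; rewrite [~~ false]/=.
Qed.

End LimitGraph.

Local Open Scope ring_scope.

(** * Auxiliary measure theory *)

Lemma measurable_support (R : realType) disp (T : measurableType disp) (g : T -> R) :
  measurable_fun setT g -> measurable [set x | g x != 0].
Proof.
move=> mg; rewrite (_ : [set _ | _] = setT `&` g @^-1` (~` [set 0])).
  by apply: mg => //; apply: measurableC; exact: measurable_set1.
by rewrite setTI; apply/seteqP; split => x /= /eqP.
Qed.

Lemma probability_cvg (R : realType) disp (T : measurableType disp)
    (P : probability T R) (S_ : nat -> set T) (S : set T) :
  (forall n, measurable (S_ n)) -> measurable S ->
  (forall x, \forall n \near \oo, S_ n x <-> S x) ->
  P (S_ n) @[n --> \oo] --> P S.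
Proof.
move=> mS_ mS near_eq.
pose f_ n x : \bar R := (\1_(S_ n) x)%:E.
have [] := @dominated_convergence _ _ _ P setT measurableT f_
  (fun x => (\1_S x)%:E) (cst 1%E).
- by move=> n; apply/measurable_EFinP; exact: measurable_indic.
- by apply/measurable_EFinP; exact: measurable_indic.
- apply: aeW => x _; apply: cvg_near_cst.
  apply: filterS (near_eq x) => n e; rewrite /f_ !indicE; congr (_%:R%:E).
  by apply: congr1; apply/idP/idP; rewrite !inE => /e.
- exact: finite_measure_integrable_cst.
- apply: aeW => x n _; rewrite /f_ indicE.
  by case: (_ \in _); rewrite /= ?normr1 ?normr0 ?abse1 ?abse0 ?lee_fin.
move=> _ _; rewrite integral_indic // setIT; apply: cvg_trans.
by apply: near_eq_cvg; apply: nearW => n; rewrite /= /f_ integral_indic // setIT.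
Qed.

Lemma measure_equal_cells (R : realType) disp (T : measurableType disp)
    (mu : {measure set T -> \bar R}) (F : nat -> set T) (N : nat) (w : R) (Q : pred nat) :
  (forall v, (v < N)%N -> measurable (F v)) ->
  (forall u v, u <> v -> F u `&` F v = set0) ->
  (forall v, (v < N)%N -> mu (F v) = w%:E) ->
  mu (\big[setU/set0]_(v < N | Q v) F v) = ((\sum_(v < N | Q v) 1)%N%:R * w)%:E.
Proof.
move=> mF dF Fw.
have := measure_bigsetU_ord_cond mu (P := [pred v : 'I_N | Q v]) (F := fun v => F v).
move=> -> /=; first last.
- apply/trivIsetP => i j _ _ neq; apply: dF => e; move: neq.
  by rewrite -val_eqE /= e eqxx.
- by move=> i _; exact: mF.
under eq_bigr => i _ do rewrite Fw //.
by rewrite sumEFin natr_sum mulr_suml; congr (_%:E); apply: eq_bigr => i _; rewrite mul1r.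
Qed.

Lemma counting_image (R : realType) (T : choiceType) (d : nat) (f : nat -> T) (P : set T) :
  (forall r r', (r < d)%N -> (r' < d)%N -> f r = f r' -> r = r') ->
  counting ([set y | exists2 r, (r < d)%N & f r = y] `&` P) =
  (\sum_(r < d) (\1_P (f r))%:E)%E :> \bar R.
Proof.
move=> finj.
pose p := [pred r : 'I_d | f r \in P].
pose F := [fset f (r : 'I_d) | r in p]%fset.
have -> : [set y | exists2 r, (r < d)%N & f r = y] `&` P = [set` F].
  apply/seteqP; split => y /=.
    move=> [[r rd <-] Pr]; apply/imfsetP; exists (Ordinal rd) => //.
    exact: (mem_set Pr : p (Ordinal rd)).
  by move=> /imfsetP[r rp ->]; split; [exists r | exact: set_mem (rp : p r)].
rewrite /counting asboolT // set_fsetK card_in_imfset /=; last first.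
  by move=> r r' _ _ /finj e; apply: val_inj; exact: e.
rewrite sumEFin; congr (_%:E); rewrite -cardE -sum1_card natr_sum big_mkcond /=.
by apply: eq_bigr => r _; rewrite indicE inE; case: (_ \in P).
Qed.

Section SetFunctionIntegral.
Import HBNNSimple.

(** Meant for [edge_measure], which is a bare set function. The integral is built from simple
    functions and so only sees values on measurable sets. *)
Lemma eq_set_function_integral (R : realType) disp (T : measurableType disp)
    (m1 m2 : set T -> \bar R) (f : T -> \bar R) :
  (forall A, measurable A -> m1 A = m2 A) ->
  (\int[m1]_x f x = \int[m2]_x f x)%E.
Proof.
move=> m12; rewrite /integral /=.
have eqs (h : {nnsfun T >-> R}) : sintegral m1 h = sintegral m2 h.
  by rewrite /sintegral; apply: eq_fsbigr => x _; rewrite m12.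
by congr (ereal_sup _ - ereal_sup _)%E; apply: eq_imagel => h _; exact: eqs.
Qed.

End SetFunctionIntegral.

(** The sets over which [f] integrates to 0 form a Dynkin system; the vanishing total integral gives
    the whole space and the complements. *)
Lemma integral_generator_eq0 (R : realType) disp (T : measurableType disp)
    (mu : {measure set T -> \bar R}) (G : set (set T)) (f : T -> \bar R) :
  @measurable _ T = <<s G >> -> setI_closed G -> mu.-integrable setT f ->
  (\int[mu]_x f x = 0)%E ->
  (forall A, G A -> \int[mu]_(x in A) f x = 0)%E ->
  f = cst 0%E %[ae mu].
Proof.
move=> mG GI intf fT fG.
apply: (@integral_ae_eq _ _ _ mu setT measurableT (cst 0%E) f) => //.
move=> A _ mA; rewrite integral0; move: A mA.
have intfA A : measurable A -> mu.-integrable A f.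
  by move=> mA; apply: integrableS intf.
rewrite [X in forall A, X A -> _]mG; apply: (dynkin_induction mG GI) => //.
- move=> S mS fS; move: fT; rewrite -(setUv S) integral_setU //.
  + by rewrite fS add0e.
  + exact: measurableC.
  + by rewrite setUv; case/integrableP: intf.
  + by apply/disj_set2P; exact: setICr.
- move=> F mF tF fF; rewrite integral_bigcup //; last first.
    by apply: intfA; exact: bigcupT_measurable.
  by rewrite eseries0.
Qed.

Lemma measurable_realE (R : realType) : @measurable _ R = <<s open >>.
Proof.
apply/seteqP; split.
  have -> : @measurable _ R = <<s @RGenInftyO.G R >> := RGenInftyO.measurableE R.
  apply: smallest_sub.
    exact: smallest_sigma_algebra.
  by move=> _ [x ->]; apply: sub_sigma_algebra; exact: interval_open.
apply: smallest_sub; first exact: sigma_algebra_measurable.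
by move=> A; exact: open_measurable.
Qed.

(** * Mixed radix expansions of the reals in [0, 2) *)

Section Digits.
Context (R : realType) (d : nat).
Hypothesis d_gt0 : (0 < d)%N.
Local Notation W n := ((width d n)%:R : R).

(** Not a single digit but the whole expansion truncated at stage [n]: the index of the interval of
    length [1 / W n] containing [x]. For [x] in [0, 2) it is a vertex of the [n]-th graph, with [0,
    1) as side A. *)
Definition digit (n : nat) (x : R) : nat := Num.truncn (x * W n).

Lemma W_gt0 n : 0 < W n.
Proof. by rewrite ltr0n width_gt0. Qed.

Lemma digit_def n (x : R) c : c%:R <= x * W n < c.+1%:R -> digit n x = c.
Proof. exact: truncn_def. Qed.

Lemma digit_itv n (x : R) : 0 <= x ->
  (digit n x)%:R <= x * W n < (digit n x).+1%:R.
Proof. by move=> x0; apply: truncn_itv; rewrite mulr_ge0 // ltW // W_gt0. Qed.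

Lemma digit_lt n (x : R) : 0 <= x < 2 -> (digit n x < (width d n).*2)%N.
Proof.
move=> /andP[x0 x2]; rewrite truncn_lt_nat; last by rewrite mulr_ge0 // ltW // W_gt0.
by rewrite -mul2n natrM ltr_pM2r // W_gt0.
Qed.

Lemma digit_parent n (x : R) : 0 <= x ->
  parent d (top n) (digit n.+1 x) = digit n x.
Proof.
move=> x0; apply/esym/digit_def.
have /andP[lo hi] := digit_itv n.+1 x0.
set v := digit _ _ in lo hi *.
have N0 : (0 < fanout d n)%N by exact: fanout_gt0.
have NR : 0 < (fanout d n)%:R :> R by rewrite ltr0n.
have vE : (v = parent d (top n) v * fanout d n + v %% fanout d n)%N by exact: divn_eq.
have vm : (v %% fanout d n < fanout d n)%N by rewrite ltn_mod.
move: lo hi; rewrite widthS natrM mulrA.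
set u := parent _ _ _ in vE *; rewrite vE => lo hi.
apply/andP; split.
  rewrite -(ler_pM2r NR); apply: le_trans lo.
  by rewrite -natrM ler_nat leq_addr.
rewrite -(ltr_pM2r NR); apply: lt_le_trans hi _.
by rewrite -natrM ler_nat mulSn addnC -addSn leq_add2r.
Qed.

Lemma width_ge_nat n : n%:R <= W n.
Proof.
rewrite ler_nat; apply: leq_trans (width_ge d_gt0 n).
by elim: n => // n IHn; rewrite expnS mul2n -addnn -addn1 leq_add // expn_gt0.
Qed.

Lemma digit_inj (x y : R) : 0 <= x -> 0 <= y ->
  (exists n0, forall n, (n0 <= n)%N -> digit n x = digit n y) -> x = y.
Proof.
move=> x0 y0 [n0 eqd]; apply/eqP; rewrite -subr_eq0 -normr_eq0; apply/negPn/negP => neq.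
have dpos : 0 < `|x - y| by rewrite lt_def neq normr_ge0.
pose n := maxn n0 (Num.truncn `|x - y|^-1).+1.
have en := eqd n (leq_maxl _ _).
have := digit_itv n x0; have := digit_itv n y0; rewrite en.
move=> /andP[ly hy] /andP[lx hx].
have : `|x - y| * W n < 1.
  rewrite -[W n]gtr0_norm ?W_gt0 // -normrM mulrBl ltr_norml.
  by move: ly hy lx hx; rewrite -natr1; lra.
have : 1 <= `|x - y| * W n.
  rewrite mulrC -ler_pdivrMr // mul1r.
  apply: le_trans (ltW (truncnS_gt _)) _; apply: le_trans (width_ge_nat n).
  by rewrite ler_nat leq_maxr.
by move=> a b; move: (le_lt_trans a b); rewrite ltxx.
Qed.

(** The sequence describes nested half-open intervals, whose intersection could be empty if the
    right endpoints became constant. Being [spread] prevents this: eventually the level is below the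
    top, and the right endpoints decrease strictly. *)
Lemma digit_limit (y : nat -> nat) n0 :
  (forall n, (n0 <= n)%N -> parent d (top n) (y n.+1) = y n) ->
  (forall n, (n0 <= n)%N -> (y n < (width d n).*2)%N) -> spread d y ->
  exists x : R, 0 <= x < 2 /\ forall n, (n0 <= n)%N -> digit n x = y n.
Proof.
move=> coh bnd spr.
pose lo n : R := (y n)%:R / W n.
pose hi n : R := (y n).+1%:R / W n.
(* Here [c] is the rank of [y n.+1] among the children of [y n]; below the top level it is not the
   last one. *)
have split n : (n0 <= n)%N -> exists2 c, (c < fanout d n)%N &
    y n.+1 = (y n * fanout d n + c)%N /\
    ((level d (top n) (y n.+1) < top n)%N -> (c.+1 < fanout d n)%N).
  move=> nn; exists (y n.+1 %% fanout d n)%N; first by rewrite ltn_mod fanout_gt0.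
  split; first by rewrite -[in RHS](coh n nn); exact: divn_eq.
  rewrite /level ltn_divLR // -/(fanout d n) => h.
  apply: leq_ltn_trans h _; rewrite /fanout; nia.
have NR n : 0 < (fanout d n)%:R :> R by rewrite ltr0n fanout_gt0.
have lo_le n : (n0 <= n)%N -> lo n <= lo n.+1.
  move=> nn; have [c cN [yE _]] := split n nn.
  rewrite /lo widthS natrM invfM mulrA ler_pdivlMr ?NR //.
  by rewrite mulrAC ler_pM2r ?invr_gt0 ?W_gt0 // -natrM ler_nat yE leq_addr.
have hi_le n : (n0 <= n)%N -> hi n.+1 <= hi n.
  move=> nn; have [c cN [yE _]] := split n nn.
  rewrite /hi widthS natrM invfM mulrA ler_pdivrMr ?NR //.
  rewrite mulrAC ler_pM2r ?invr_gt0 ?W_gt0 // -natrM ler_nat.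
  by rewrite yE mulSn -addnS addnC leq_add2r.
have hi_lt n : (n0 <= n)%N -> (level d (top n) (y n.+1) < top n)%N -> hi n.+1 < hi n.
  move=> nn lt; have [c cN [yE /(_ lt) cN']] := split n nn.
  rewrite /hi widthS natrM invfM mulrA ltr_pdivrMr ?NR //.
  rewrite mulrAC ltr_pM2r ?invr_gt0 ?W_gt0 // -natrM ltr_nat.
  by rewrite yE mulSn -addnS addnC ltn_add2r.
have lo_mono n m : (n0 <= n)%N -> (n <= m)%N -> lo n <= lo m.
  move=> nn /subnKC <-; elim: (m - n)%N => [|j IHj]; first by rewrite addn0.
  by rewrite addnS (le_trans IHj) // lo_le // (leq_trans nn) // leq_addr.
have hi_mono n m : (n0 <= n)%N -> (n <= m)%N -> hi m <= hi n.
  move=> nn /subnKC <-; elim: (m - n)%N => [|j IHj]; first by rewrite addn0.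
  by rewrite addnS (le_trans _ IHj) // hi_le // (leq_trans nn) // leq_addr.
have lo_hi n : lo n < hi n by rewrite /lo /hi ltr_pM2r ?invr_gt0 ?W_gt0 // ltr_nat.
pose S := [set lo n | n in [set n | (n0 <= n)%N]].
have S0 : S !=set0 by exists (lo n0); exists n0 => /=.
have lo_hi2 n m : (n0 <= n)%N -> (n0 <= m)%N -> lo m <= hi n.
  move=> nn nm; case: (leqP n m) => [le|/ltnW le].
    by apply: le_trans (ltW (lo_hi m)) (hi_mono _ _ nn le).
  by apply: le_trans (lo_mono _ _ nm le) (ltW (lo_hi n)).
have ubS n : (n0 <= n)%N -> ubound S (hi n).
  by move=> nn _ [m /= nm <-]; exact: lo_hi2.
have supS : has_sup S by split => //; exists (hi n0); exact: ubS.
have lo_sup n : (n0 <= n)%N -> lo n <= sup S.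
  by move=> nn; apply: sup_ubound => //; [case: supS | exists n].
have sup_hi n : (n0 <= n)%N -> sup S < hi n.
  move=> nn; have [n1 sp] := spr 1%N.
  pose m := maxn n n1.
  have nm : (n0 <= m)%N by rewrite (leq_trans nn) // leq_maxl.
  have [_ lt] := sp m (leq_maxr _ _).
  apply: (@le_lt_trans _ _ (hi m.+1)).
    by apply: ge_sup => //; apply: ubS; rewrite leqW.
  apply: lt_le_trans (hi_mono _ _ nn (leq_maxl n n1)).
  by apply: hi_lt => //; rewrite -addn1.
exists (sup S); split.
  apply/andP; split.
    by apply: le_trans (lo_sup n0 _) => //; rewrite /lo divr_ge0 // ?ler0n.
  apply: lt_le_trans (sup_hi n0 _) _ => //.
  by rewrite /hi ler_pdivrMr ?W_gt0 // -natrM ler_nat mul2n bnd.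
move=> n nn; apply: digit_def; rewrite -ler_pdivrMr ?W_gt0 // -ltr_pdivlMr ?W_gt0 //.
by rewrite lo_sup // sup_hi.
Qed.

End Digits.

(** * Uniform measure of the cells *)

Section Uniform.
Context (R : realType) (d : nat).
Hypothesis d_gt0 : (0 < d)%N.
Local Notation W n := ((width d n)%:R : R).
Local Notation P := (uniform_prob (ltr0n R 2)).

Definition cell (n c : nat) : set R := `[c%:R / W n, c.+1%:R / W n[.

Lemma cellE n c : cell n c = [set x | 0 <= x /\ digit d n x = c].
Proof.
apply/seteqP; split => x; rewrite /cell /= in_itv /= ler_pdivrMr ?ltr_pdivlMr ?W_gt0 //.
  move=> /andP[lo hi]; split; last by apply: digit_def; rewrite lo hi.
  by rewrite -(pmulr_lge0 _ (W_gt0 R d_gt0 n)); apply: le_trans lo.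
by move=> [x0 <-]; exact: digit_itv.
Qed.

Lemma prob_cell n c : (c < (width d n).*2)%N -> P (cell n c) = ((width d n).*2%:R^-1)%:E.
Proof.
move=> cW; rewrite /uniform_prob integral_uniform_pdf.
have hi2 : c.+1%:R / W n <= 2.
  by rewrite ler_pdivrMr ?W_gt0 // -natrM ler_nat mul2n.
have lo0 : 0 <= c%:R / W n by rewrite divr_ge0.
rewrite (_ : _ `&` _ = cell n c); last first.
  apply/seteqP; split => [x []//|x Cx]; split => //.
  move: Cx; rewrite /cell /= !in_itv /= => /andP[lo hi].
  by rewrite (le_trans lo0 lo) (le_trans (ltW hi) hi2).
rewrite (eq_integral (fun=> (2 - 0)^-1%:E)); last first.
  move=> x; rewrite inE /cell /= in_itv /= => /andP[lo hi].
  by rewrite /uniform_pdf (le_trans lo0 lo) (le_trans (ltW hi) hi2).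
have mC : measurable (cell n c) by exact: measurable_itv.
rewrite integral_cst //= /cell.
rewrite lebesgue_measure_itv /= lte_fin ltr_pM2r ?invr_gt0 ?W_gt0 //.
rewrite ltr_nat ltnSn -EFinD -EFinM; congr (_%:E).
rewrite -mulrBl -(addn1 c) natrD (addrC c%:R) addrK div1r subr0 -mul2n natrM invfM.
by [].
Qed.

Lemma measurable_cell n c : measurable (cell n c).
Proof. exact: measurable_itv. Qed.

Lemma finite_levelE n (Q : pred nat) :
  [set x : R | 0 <= x < 2 /\ Q (digit d n x)] =
  \big[setU/set0]_(v < (width d n).*2 | Q v) cell n v.
Proof.
rewrite -(bigcup_pred [pred v : 'I_(width d n).*2 | Q v] (fun v => cell n v)).
apply/seteqP; split => x /=.
  move=> [x02 Qx]; exists (Ordinal (digit_lt d_gt0 n x02)) => //=.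
  by rewrite cellE; split => //; case/andP: x02.
move=> [[v vW] /= Qv]; rewrite cellE => -[x0 xv]; rewrite x0 xv; split => //.
have /andP[_ hi] := digit_itv d n x0.
rewrite -(ltr_pM2r (W_gt0 R d_gt0 n)); apply: lt_le_trans hi _.
by rewrite xv -natrM ler_nat mul2n.
Qed.

Lemma measurable_finite_level n (Q : pred nat) :
  measurable [set x : R | 0 <= x < 2 /\ Q (digit d n x)].
Proof.
by rewrite finite_levelE; apply: bigsetU_measurable => i _; exact: measurable_cell.
Qed.

Lemma prob_finite_level n (Q : pred nat) :
  P [set x : R | 0 <= x < 2 /\ Q (digit d n x)] =
  ((\sum_(v < (width d n).*2 | Q v) 1)%N%:R / (width d n).*2%:R)%:E.
Proof.
rewrite finite_levelE.
have dF u v : u <> v -> cell n u `&` cell n v = set0.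
  move=> neq; rewrite !cellE; apply/seteqP; split => // x [] /= [_ xu] [_ xv].
  by apply: neq; rewrite -xu -xv.
exact: (@measure_equal_cells R _ _ P (cell n) _ _ Q
  (fun v _ => measurable_cell n v) dF (@prob_cell n)).
Qed.

End Uniform.

(** * Almost every real stays away from the ends of the covers *)

Section GoodPoints.
Context (R : realType) (d : nat).
Hypothesis d_gt0 : (0 < d)%N.
Local Notation W n := ((width d n)%:R : R).
Local Notation P := (uniform_prob (ltr0n R 2)).

Definition extreme (k n v : nat) : bool :=
  ~~ ((k <= level d (top n) v) && (level d (top n) v + k <= top n))%N.

Lemma card_extreme k n :
  (\sum_(v < (width d n.+1).*2 | extreme k n v) 1 <= (width d n).*2 * d * k.*2)%N.
Proof.
rewrite sum1_card.
pose A := [pred v : 'I_(width d n.+1).*2 | extreme k n v].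
have dgt v : (copy d v < d)%N by rewrite ltn_mod.
have pl (v : 'I_(width d n.+1).*2) : (parent d (top n) v < (width d n).*2)%N.
  by apply: parent_lt => //; rewrite -doubleMl -widthS.
(* The extreme levels are encoded by numbers below [k.*2]: low ones by themselves, high ones by [k]
   plus the distance to the top. *)
pose c (v : nat) := if (level d (top n) v < k)%N then level d (top n) v
  else (k + (top n - level d (top n) v))%N.
have [k0|k0] := posnP k.
  rewrite k0 muln0 leqn0; apply/eqP/eq_card0 => v; rewrite unfold_in /= /extreme.
  by rewrite addn0 level_le.
have cl (v : 'I_(width d n.+1).*2) : v \in A -> (c v < k.*2)%N.
  rewrite inE /extreme /c; have := level_le (top n) d_gt0 v.
  move: (top n) (level _ _ _) => t l; rewrite negb_and -!ltnNge.
  by case: ifP => lk; lia.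
have k20 : (0 < k.*2)%N by rewrite double_gt0.
(* The remainder modulo [k.*2] makes the map total; on [A] it changes nothing. *)
pose f (v : 'I_(width d n.+1).*2) : 'I_(width d n).*2 * 'I_d * 'I_k.*2 :=
  (Ordinal (pl v), Ordinal (dgt v), Ordinal (ltn_pmod (c v) k20)).
have finj : {in A &, injective f}.
  move=> u v uA vA [pe ce]; rewrite !modn_small ?cl // => le.
  apply: val_inj => /=; rewrite -[LHS](childK d (top n)) -[RHS](childK d (top n)) pe ce.
  congr (child _ _ _ _ _); move: le uA vA; rewrite !inE /extreme /c.
  have := level_le (top n) d_gt0 u; have := level_le (top n) d_gt0 v.
  move: (top n) (level _ _ v) (level _ _ u) => t l l' lt l't.
  by rewrite !negb_and -!ltnNge; case: ifP => lk; case: ifP => l'k; lia.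
have := leq_card_in f A finj; rewrite !card_prod !card_ord; apply: leq_trans.
by [].
Qed.

Definition extreme_points (k n : nat) : set R :=
  [set x | 0 <= x < 2 /\ extreme k n (digit d n.+1 x)].

(** By counting, the proportion is at most [2k / (2^n + 1)]; the bound has the shape [C / 2 ^ n.+1]
    that [epsilon_trick0] sums. *)
Lemma prob_extreme k n : (P (extreme_points k n) <= (k.*2%:R * 2 / (2 ^ n.+1)%:R)%:E)%E.
Proof.
rewrite (prob_finite_level R d_gt0 n.+1 (extreme k n)) lee_fin.
apply: (@le_trans _ _ (((width d n).*2 * d * k.*2)%:R / (width d n.+1).*2%:R)).
  by rewrite ler_pM2r ?invr_gt0 ?ltr0n ?double_gt0 ?width_gt0 // ler_nat card_extreme.
rewrite ler_pdivrMr ?ltr0n ?double_gt0 ?width_gt0 //.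
rewrite mulrAC ler_pdivlMr ?ltr0n ?expn_gt0 // -!natrM ler_nat.
rewrite widthS /fanout expnS -/(top n) -!muln2; set w := width _ _; set t := top n.
nia.
Qed.

Definition points : set R := [set x | 0 <= x < 2 /\ spread d (digit d ^~ x)].

Lemma pointsE : points = `[0, 2[ `\` \bigcup_k lim_sup_set (extreme_points k).
Proof.
apply/seteqP; split => x /=.
  move=> [x02 spr]; split; first by rewrite in_itv.
  move=> [k _ ls]; have [n0 good] := spr k.
  have [n /= n0n [_ /negP]] := ls n0 I.
  by have [-> ->] := good n n0n.
rewrite in_itv /= => -[x02 nbad]; split => // k.
apply: contrapT => ngood; apply: nbad; exists k => // n0 _.
apply: contrapT => nex; apply: ngood; exists n0 => n n0n.
apply/andP; apply/negPn/negP => ext; apply: nex; exists n => //.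
Qed.

Lemma measurable_extreme k n : measurable (extreme_points k n).
Proof. exact: measurable_finite_level. Qed.

Lemma measurable_limsup_extreme k : measurable (lim_sup_set (extreme_points k)).
Proof.
apply: bigcapT_measurable => n; apply: bigcup_measurable => m _.
exact: measurable_extreme.
Qed.

Lemma measurable_points : measurable points.
Proof.
rewrite pointsE; apply: measurableD; first exact: measurable_itv.
by apply: bigcupT_measurable => k; exact: measurable_limsup_extreme.
Qed.

(** Borel-Cantelli for each margin [k], followed by a countable union. *)
Lemma prob_points : P points = 1%E.
Proof.
have P02 : P `[0, 2[ = 1%E.
  have := prob_finite_level R d_gt0 0 xpredT; rewrite sum1_card card_ord.
  rewrite divff ?pnatr_eq0 -?lt0n ?double_gt0 ?width_gt0 // => <-; congr (P _).
  by apply/seteqP; split => x /=; rewrite in_itv /= => // -[].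
have null : P (\bigcup_k lim_sup_set (extreme_points k)) = 0%E.
  apply: measure_negligible; first exact: bigcupT_measurable measurable_limsup_extreme.
  apply: negligible_bigcup => k.
  apply/negligibleP; first exact: measurable_limsup_extreme.
  apply: lim_sup_set_cvg0; first exact: measurable_extreme.
  apply: (@le_lt_trans _ _ (\sum_(n <oo) (k.*2%:R * 2 / (2 ^ n.+1)%:R)%:E)%E).
    by apply: lee_nneseries => n *; [exact: measure_ge0 | exact: prob_extreme].
  apply: le_lt_trans (epsilon_trick0 _ _) _; last exact: ltry.
  by rewrite mulr_ge0.
rewrite pointsE measureD //=; first last.
- by rewrite P02 ltry.
- by apply: bigcupT_measurable => k; exact: measurable_limsup_extreme.
rewrite P02; set N := P (_ `&` _); suff -> : N = 0%E by rewrite sube0.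
apply/eqP; rewrite -measure_le0 -null; apply: le_measure; rewrite ?inE.
- apply: measurableI => //; apply: bigcupT_measurable => k.
  exact: measurable_limsup_extreme.
- by apply: bigcupT_measurable => k; exact: measurable_limsup_extreme.
- exact: subIsetr.
Qed.

End GoodPoints.

(** * The standard Borel probability space of these reals *)

Section PointSpace.
Context (R : realType) (d : nat) (d_gt0 : (0 < d)%N).
Local Notation W n := ((width d n)%:R : R).

(* The idle [d_gt0] is what makes a canonical point available. *)
Definition point_space : Type := let _ := d_gt0 in {x : R | x \in @points R d}.
HB.instance Definition _ := Choice.on point_space.

Lemma points_neq0 : exists x : R, x \in @points R d.
Proof.
have [P0|/set0P[x Px]] := eqVneq (@points R d) set0; last by exists x; rewrite inE.
by have := prob_points R d_gt0; rewrite P0 measure0 => /eqP; rewrite eq_sym onee_eq0.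
Qed.

HB.instance Definition _ := isPointed.Build point_space
  (exist _ (xchoose points_neq0) (xchooseP points_neq0)).

Definition coordinate (n : nat) (x : point_space) : nat := digit d n (sval x).

Definition cylinders (T : Type) (D : nat -> T -> nat) : set (set T) :=
  range (fun nc : nat * nat => D nc.1 @^-1` [set nc.2]).

(** With the cylinders as generators, measurability and equality of measures can be tested on
    coordinates. That the sigma-algebra is the trace of the Borel sets of the line is part of
    [standard_borel_coord_space]. *)
Definition coord_space := g_sigma_algebraType (cylinders coordinate).

Definition retract (x : measurableTypeR R) : coord_space := insubd (point : point_space) x.

Lemma retractK (x : R) : @points R d x -> sval (retract x : point_space) = x.
Proof. by move=> Px; rewrite /retract -[LHS]/(val _) insubdK // inE. Qed.

Lemma sval_points (x : point_space) : @points R d (sval x).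
Proof. by have := valP x; rewrite inE. Qed.

Lemma measurable_retract : measurable_fun [set: measurableTypeR R] retract.
Proof.
apply: (measurability (rT := coord_space) (cylinders coordinate)) => //.
move=> _ [_ [[n c] _ <-] <-]; rewrite setTI /=.
(* Off [points] the map is constant, equal to the default point, so the second set is all of the
   complement or empty. *)
rewrite (_ : _ @^-1` _ = (@points R d `&` @cell R d n c) `|`
    (~` @points R d `&` [set x : R | coordinate n point = c])).
  apply: measurableU.
    by apply: measurableI; [exact: measurable_points | exact: measurable_cell].
  apply: measurableI; first by apply: measurableC; exact: measurable_points.
  have [e|e] := pselect (coordinate n point = c).
    by rewrite (_ : [set _ | _] = setT) //; apply/seteqP; split.
  by rewrite (_ : [set _ | _] = set0) //; apply/seteqP; split.
apply/seteqP; split => x.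
  rewrite /= /coordinate; have [Px|nPx] := pselect (@points R d x).
    rewrite retractK // => xc; left; split => //; rewrite cellE //; split => //.
    by case: Px => /andP[].
  rewrite /retract /insubd insubN; last by apply/negP; rewrite inE.
  by move=> pc; right.
rewrite /= /coordinate => -[[Px]|[nPx pc]].
  by rewrite cellE // retractK // => -[].
by rewrite /retract /insubd insubN //; apply/negP; rewrite inE.
Qed.

HB.instance Definition _ := isMeasurableFun.Build _ _ _ _ retract measurable_retract.

Definition coord_prob : probability coord_space R :=
  distribution (uniform_prob (ltr0n R 2)) retract.

Lemma coord_probE (n c : nat) : (c < (width d n).*2)%N ->
  coord_prob [set x | coordinate n x = c] = ((width d n).*2%:R^-1)%:E.
Proof.
move=> cW; rewrite -(prob_cell R d_gt0 cW).
have mp : measurable (@points R d) by exact: measurable_points.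
have Pp (A : set (measurableTypeR R)) : measurable A ->
    uniform_prob (ltr0n R 2) A = uniform_prob (ltr0n R 2) (A `&` @points R d).
  move=> mA; rewrite (measureDI _ mA mp) [X in (X + _)%E](_ : _ = 0%E) ?add0e //.
  apply: (subset_measure0 (mu := uniform_prob (ltr0n R 2)) (B := ~` @points R d)).
  - exact: measurableD.
  - exact: measurableC.
  - by move=> x [].
  - have := probability_setC (uniform_prob (ltr0n R 2)) mp.
    by rewrite [X in (_ - X)%E](prob_points R d_gt0) subee.
have mA : measurable (retract @^-1` [set x | coordinate n x = c]).
  rewrite -[_ @^-1` _]setTI; apply: measurable_retract => //.
  by apply: sub_sigma_algebra; exists (n, c).
rewrite (Pp (cell d n c)); last exact: measurable_cell.
transitivity (uniform_prob (ltr0n R 2) (retract @^-1` [set x | coordinate n x = c])).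
  by [].
rewrite Pp //; congr (uniform_prob _ _); rewrite cellE //.
apply/seteqP; split => x [] /=; rewrite /coordinate => xc px; split => //.
  by move: xc; rewrite retractK //; split => //; case: px => /andP[].
by rewrite retractK //; case: xc.
Qed.

Lemma measurable_cylinder n c : measurable ([set x | coordinate n x = c] : set coord_space).
Proof. by apply: sub_sigma_algebra; exists (n, c). Qed.

Lemma coordinate_itv n (x : point_space) :
  (coordinate n x)%:R <= sval x * W n < (coordinate n x).+1%:R.
Proof. by apply: digit_itv; case: (sval_points x) => /andP[]. Qed.

(** This writes a half-line as a countable union of cylinders, those whose interval ends at or
    before [q]; it makes [sval] measurable. *)
Lemma sval_lt (x : point_space) (q : R) :
  sval x < q <-> exists nc : nat * nat, nc.2.+1%:R <= q * W nc.1 /\ coordinate nc.1 x = nc.2.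
Proof.
split => [xq|[[n c] /= [cq xc]]]; last first.
  have /andP[_] := coordinate_itv n x; rewrite xc => /lt_le_trans /(_ cq).
  by rewrite ltr_pM2r // W_gt0.
have dpos : 0 < q - sval x by rewrite subr_gt0.
pose n := (Num.truncn (q - sval x)^-1).+1.
exists (n, coordinate n x); split => //=.
have /andP[lo _] := coordinate_itv n x.
have : 1 <= (q - sval x) * W n.
  rewrite mulrC -ler_pdivrMr // mul1r.
  by apply: le_trans (ltW (truncnS_gt _)) _; exact: width_ge_nat.
by rewrite mulrBl -natr1; lra.
Qed.

Lemma measurable_sval : measurable_fun [set: coord_space] (sval : coord_space -> R).
Proof.
apply: (measurability (rT := measurableTypeR R) (@RGenInftyO.G R)).
  exact: RGenInftyO.measurableE.
move=> _ [_ [q ->] <-]; rewrite setTI.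
rewrite (_ : _ @^-1` _ = \bigcup_(nc : nat * nat)
    (if nc.2.+1%:R <= q * W nc.1 then [set x | coordinate nc.1 x = nc.2] else set0)).
  apply: countable_bigcupT_measurable => [|[n c] /=]; first exact: countableP.
  by case: ifP => _; [exact: measurable_cylinder | exact: measurable0].
apply/seteqP; split => x /=; rewrite in_itv /= sval_lt.
  by move=> [nc [h1 h2]]; exists nc => //; rewrite h1.
by move=> [nc _]; case: ifP => // h1 h2; exists nc.
Qed.

Lemma standard_borel_coord_space : standard_borel R coord_space.
Proof.
exists (R^o : completePseudoMetricType R), (sval : coord_space -> R).
have rangeE : range (sval : coord_space -> R) = @points R d.
  apply/seteqP; split => [_ [x _ <-]|x px]; first exact: sval_points.
  by exists (retract x) => //; exact: retractK.
have svali : injective (sval : coord_space -> R) by exact: val_inj.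
have mE : @measurable _ R = <<s open >> := measurable_realE R.
split.
- exact: norm_hausdorff.
- exists (range ratr); split; last exact: dense_rat.
  by apply: (card_le_trans (card_image_le _ _)); exact: countableP.
- exact: svali.
- by rewrite rangeE -mE; exact: measurable_points.
move=> A; rewrite -mE; split; last first.
  move=> mA; have -> : A = [set: coord_space] `&` sval @^-1` (sval @` A).
    rewrite setTI; apply/seteqP; split => [x Ax|x [y Ay /svali <-] //].
    by exists x.
  exact: measurable_sval.
(* The sets with Borel image form a sigma-algebra: complements pass through because [sval] is
   injective with Borel range. *)
pose S := [set A : set coord_space | measurable (sval @` A : set R)].
suff : <<s cylinders coordinate >> `<=` S by apply.
apply: smallest_sub; last first.
  move=> _ [[n c] _ <-]; rewrite /S /=.
  rewrite (_ : _ @` _ = @points R d `&` @cell R d n c).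
    by apply: measurableI; [exact: measurable_points | exact: measurable_cell].
  rewrite cellE //; apply/seteqP; split => [_ [x /= xc <-]|x /= [px [x0 xc]]].
    by split; [exact: sval_points | split => //; case: (sval_points x) => /andP[]].
  by exists (retract x); rewrite /coordinate ?retractK.
split; rewrite /S /=.
- by rewrite image_set0; exact: measurable0.
- move=> B mB; rewrite (_ : _ @` _ = @points R d `\` (sval @` B)).
    by apply: measurableD => //; exact: measurable_points.
  apply/seteqP; split => [_ [x [_ nBx] <-]|x [px nB]].
    by split; [exact: sval_points | move=> [y By /svali yx]; apply: nBx; rewrite -yx].
  exists (retract x); last exact: retractK.
  by split => // Bx; apply: nB; exists (retract x) => //; exact: retractK.
- by move=> F mF; rewrite image_bigcup; exact: bigcupT_measurable.
Qed.

Lemma coordinate_lt n (x : point_space) : (coordinate n x < (width d n).*2)%N.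
Proof. by apply: digit_lt => //; case: (sval_points x). Qed.

Lemma coordinate_parent n (x : point_space) :
  parent d (top n) (coordinate n.+1 x) = coordinate n x.
Proof. by apply: digit_parent => //; case: (sval_points x) => /andP[]. Qed.

Lemma coordinate_inj (x y : point_space) :
  (\forall n \near \oo, coordinate n x = coordinate n y) -> x = y.
Proof.
move=> [n0 _ eqc]; apply: val_inj; apply: (digit_inj d_gt0).
- by case: (sval_points x) => /andP[].
- by case: (sval_points y) => /andP[].
- by exists n0 => n /eqc.
Qed.

Lemma coordinate_spread (x : point_space) : spread d (coordinate ^~ x).
Proof. by case: (sval_points x). Qed.

Lemma coordinate_limit (y : nat -> nat) n0 :
  (forall n, (n0 <= n)%N -> parent d (top n) (y n.+1) = y n) ->
  (forall n, (n0 <= n)%N -> (y n < (width d n).*2)%N) -> spread d y ->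
  exists x : point_space, \forall n \near \oo, coordinate n x = y n.
Proof.
move=> coh bnd spr; have [x [x02 dig]] := digit_limit R d_gt0 coh bnd spr.
have xp : points d x.
  split => // k; have [n1 good] := spr k; exists (maxn n0 n1) => n.
  rewrite geq_max => /andP[n0n n1n]; rewrite dig; first exact: good.
  exact: leqW.
exists (retract x); exists n0 => // n /= n0n.
by rewrite /coordinate retractK // dig.
Qed.

Lemma coordinate_systemP : coordinate_system d coordinate.
Proof.
split; [exact: d_gt0 | exact: coordinate_lt | exact: coordinate_parent |
  exact: coordinate_inj | exact: coordinate_spread | exact: coordinate_limit].
Qed.

End PointSpace.

(** * Neighbour maps, mass transport and the edge measure *)

Section MeasuredGraph.
Context (R : realType) (d : nat) (disp : measure_display) (V : measurableType disp).
Context (nu : probability V R) (D : nat -> V -> nat).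
Hypothesis DP : coordinate_system d D.
Let d_gt0 := label_gt0 DP.
Let D_lt := coord_lt DP.
Hypothesis D_gen : @measurable _ V = <<s cylinders D >>.
Hypothesis D_prob : forall n c, (c < (width d n).*2)%N ->
  nu [set x | D n x = c] = ((width d n).*2%:R^-1)%:E.

Local Notation E := (limit_edges d D).

Lemma measurable_cyl n c : measurable [set x | D n x = c].
Proof. by rewrite D_gen; apply: sub_sigma_algebra; exists (n, c). Qed.

Lemma finite_level_setE n (Q : pred nat) :
  [set x | Q (D n x)] = \big[setU/set0]_(v < (width d n).*2 | Q v) [set x | D n x = v].
Proof.
rewrite -(bigcup_pred [pred v : 'I_(width d n).*2 | Q v] (fun v => [set x | D n x = v])).
apply/seteqP; split => x /= [].
  by move=> Qx; exists (Ordinal (D_lt n x)).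
by move=> v /= Qv ->.
Qed.

Lemma measurable_level n (Q : pred nat) : measurable [set x | Q (D n x)].
Proof.
by rewrite finite_level_setE; apply: bigsetU_measurable => v _; exact: measurable_cyl.
Qed.

Lemma prob_level n (Q : pred nat) :
  nu [set x | Q (D n x)] = ((\sum_(v < (width d n).*2 | Q v) 1)%N%:R / (width d n).*2%:R)%:E.
Proof.
rewrite finite_level_setE (measure_equal_cells (mu := nu)
  (F := fun v => [set x | D n x = v]) (w := (width d n).*2%:R^-1)) //.
- by move=> v _; exact: measurable_cyl.
- move=> u v neq; apply/seteqP; split => // x [/= xu xv]; apply: neq.
  by rewrite -xu -xv.
- by move=> v; exact: D_prob.
Qed.

Lemma cylinders_setI : setI_closed (cylinders D).
Proof.
have base n m c c' : (n <= m)%N ->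
    cylinders D ([set x | D n x = c] `&` [set x | D m x = c']).
  move=> nm; have [e|e] := eqVneq (ancestor d n m c') c.
    exists (m, c') => //; apply/seteqP; split => x /=; last by case.
    by move=> xm; split => //; rewrite -e -xm (D_ancestor DP).
  (* Cylinders are nested or disjoint; the empty set is the cylinder of a coordinate that no point
     attains. *)
  exists (0%N, (width d 0).*2) => //; apply/seteqP; split => x /=.
    by move=> x0; have := D_lt 0 x; rewrite x0 ltnn.
  move=> [xn xm]; move: e; rewrite -xm (D_ancestor DP) // xn eqxx //.
move=> _ _ [[n c] _ <-] [[m c'] _ <-] /=.
by case/orP: (leq_total n m) => h; [|rewrite setIC]; exact: base.
Qed.

Lemma cylinders_cover : \bigcup_k [set x | D 0 x = k] = setT.
Proof. by apply/seteqP; split => // x _; exists (D 0 x). Qed.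

Definition boxes : set (set (V * V)) :=
  [set A `*` B | A in cylinders D & B in cylinders D].

Lemma measurable_boxes : @measurable _ (V * V)%type = <<s boxes >>.
Proof.
apply/seteqP; split; last first.
  apply: smallest_sub; first exact: sigma_algebra_measurable.
  move=> _ [_ [[n c] _ <-] [_ [[m c'] _ <-] <-]].
  by apply: measurableX; exact: measurable_cyl.
have m1 : measurable_fun [set: g_sigma_algebraType boxes] (fst : g_sigma_algebraType boxes -> V).
  apply: (measurability (cylinders D) D_gen).
  move=> _ [_ [[n c] _ <-] <-]; rewrite setTI.
  (* Both factors of a box are cylinders, so the unrestricted factor is covered by cylinders of
     stage 0. *)
  rewrite (_ : _ @^-1` _ = \bigcup_k ([set x | D n x = c] `*` [set x | D 0 x = k])).
    apply: bigcupT_measurable => k; apply: sub_sigma_algebra.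
    exists [set x | D n x = c]; first by exists (n, c).
    by exists [set x | D 0 x = k] => //; exists (0%N, k).
  by apply/seteqP; split => [[x y] /= xc|[x y] /= [k _ []]] //; exists (D 0 y).
have m2 : measurable_fun [set: g_sigma_algebraType boxes] (snd : g_sigma_algebraType boxes -> V).
  apply: (measurability (cylinders D) D_gen).
  move=> _ [_ [[n c] _ <-] <-]; rewrite setTI.
  rewrite (_ : _ @^-1` _ = \bigcup_k ([set x | D 0 x = k] `*` [set x | D n x = c])).
    apply: bigcupT_measurable => k; apply: sub_sigma_algebra.
    exists [set x | D 0 x = k]; first by exists (0%N, k).
    by exists [set x | D n x = c] => //; exists (n, c).
  by apply/seteqP; split => [[x y] /= xc|[x y] /= [k _ []]] //; exists (D 0 x).
rewrite measurable_prod_measurableType; apply: smallest_sub.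
  exact: smallest_sigma_algebra.
move=> _ [A mA [B mB <-]].
rewrite (_ : _ `*` _ = (setT `&` fst @^-1` A) `&` (setT `&` snd @^-1` B)); last first.
  by rewrite !setTI; apply/seteqP; split => -[].
by apply: (@measurableI _ (g_sigma_algebraType boxes)); [exact: m1 | exact: m2].
Qed.

(* The junk value for [r >= d] keeps [nb r] measurable. *)
Definition nb (r : nat) (x : V) : V :=
  match pselect (r < d)%N with
  | left rd => projT1 (cid (linked_exists DP x rd))
  | right _ => x
  end.

Lemma nbP r x : (r < d)%N -> exists s, linked d D x r (nb r x) s.
Proof. by rewrite /nb; case: pselect => // rd _; case: cid. Qed.

Lemma nb_eq r x y s : (r < d)%N -> linked d D x r y s -> nb r x = y.
Proof. by move=> rd xy; have [t /(linked_fun DP xy) []] := nbP x rd. Qed.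

Lemma limit_edgesE x y : limit_edges d D (x, y) <-> exists2 r, (r < d)%N & nb r x = y.
Proof.
split => [[r [s [rd xy]]]|[r rd <-]]; first by exists r => //; exact: nb_eq xy.
by have [s xs] := nbP x rd; exists r, s.
Qed.

Lemma nb_inj x r r' : (r < d)%N -> (r' < d)%N -> nb r x = nb r' x -> r = r'.
Proof.
move=> rd r'd e; have [s xs] := nbP x rd; have [s' xs'] := nbP x r'd.
by rewrite -e in xs'; exact: (linked_injective DP rd r'd xs xs').
Qed.

(** Each coordinate of a neighbour is a limit of functions of single coordinates of [x]. Both the
    measurability of [nb] and mass transport rest on this. *)
Lemma nb_coord r x m : (r < d)%N ->
  \forall n \near \oo, ancestor d m n (mate d n (D n x, r)).1 = D m (nb r x).
Proof.
move=> rd; have [s [n0 _ xs]] := nbP x rd.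
exists (maxn n0 m) => // n /=; rewrite geq_max => /andP[n0n mn].
by rewrite (xs n n0n) /= (D_ancestor DP).
Qed.

Lemma measurable_nb r : measurable_fun [set: V] (nb r).
Proof.
have [rd|rd] := ltnP r d; last first.
  rewrite (_ : nb r = id); first exact: measurable_id.
  by apply/funext => x; rewrite /nb; case: pselect => // rd'; exfalso; move: rd'; rewrite ltnNge rd.
apply: (measurability (cylinders D) D_gen).
move=> _ [_ [[m c] _ <-] <-]; rewrite setTI /=.
rewrite (_ : _ @^-1` _ = \bigcup_N \bigcap_(n in [set n | (N <= n)%N])
    [set x | ancestor d m n (mate d n (D n x, r)).1 == c]).
  apply: bigcupT_measurable => N; apply: bigcap_measurable; first by exists N => /=.
  move=> n _; exact: (measurable_level n (fun v => ancestor d m n (mate d n (v, r)).1 == c)).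
apply/seteqP; split => x /=.
  move=> xc; have [N _ h] := nb_coord x m rd; exists N => // n /= /h.
  by rewrite /= xc => ->.
move=> [N _ h]; have [n1 _ h1] := nb_coord x m rd.
rewrite -(h1 (maxn N n1)) /=; last exact: leq_maxr.
by apply/eqP/(h (maxn N n1)); exact: leq_maxl.
Qed.

Definition out_edge (r : nat) (x : V) : V * V := (x, nb r x).
Definition in_edge (r : nat) (x : V) : V * V := (nb r x, x).

Lemma measurable_out_edge r : measurable_fun [set: V] (out_edge r).
Proof. by apply: measurable_fun_pair; [exact: measurable_id | exact: measurable_nb]. Qed.

Lemma measurable_in_edge r : measurable_fun [set: V] (in_edge r).
Proof. by apply: measurable_fun_pair; [exact: measurable_nb | exact: measurable_id]. Qed.

HB.instance Definition _ r :=
  isMeasurableFun.Build _ _ _ _ (out_edge r) (measurable_out_edge r).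
HB.instance Definition _ r :=
  isMeasurableFun.Build _ _ _ _ (in_edge r) (measurable_in_edge r).

(** Both measures count directed edges, [out_measure] from the tail and [in_measure] from the head;
    mass transport is their equality. *)
Definition out_measure := msum (fun r => distribution nu (out_edge r)) d.
Definition in_measure := msum (fun r => distribution nu (in_edge r)) d.

Lemma out_measureE S : out_measure S = (\sum_(r < d) nu [set x | S (x, nb r x)])%E.
Proof. by []. Qed.

Lemma in_measureE S : in_measure S = (\sum_(r < d) nu [set x | S (nb r x, x)])%E.
Proof. by []. Qed.

(** Mass transport in the finite graph: [mate] is an involution on the pairs of a vertex and a
    label, exchanging the ends of each edge. *)
Lemma card_mates n (A B : pred nat) :
  (\sum_(r < d) \sum_(v < (width d n).*2 | A v && B (mate d n (v : nat, r : nat)).1) 1 =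
   \sum_(r < d) \sum_(v < (width d n).*2 | A (mate d n (v : nat, r : nat)).1 && B v) 1)%N.
Proof.
rewrite !pair_big_dep /=.
have dom (p : 'I_d * 'I_(width d n).*2) := mate_dom d_gt0 (ltn_ord p.2) (ltn_ord p.1).
have fst_lt (p : 'I_d * 'I_(width d n).*2) :
    ((mate d n (p.2 : nat, p.1 : nat)).1 < (width d n).*2)%N by case: (dom p).
have snd_lt (p : 'I_d * 'I_(width d n).*2) :
    ((mate d n (p.2 : nat, p.1 : nat)).2 < d)%N by case: (dom p).
pose f p := (Ordinal (snd_lt p), Ordinal (fst_lt p)).
have ff : involutive f.
  move=> [r v]; have [_ _ + _] := dom (r, v).
  rewrite /= [X in mate d n X]surjective_pairing => e.
  by congr pair; apply: val_inj => /=; rewrite e.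
rewrite (reindex_inj (can_inj ff)) /=; apply: eq_bigl => -[r v] /=.
have [_ _ + _] := dom (r, v).
by rewrite /= [X in mate d n X]surjective_pairing => ->.
Qed.

Lemma out_measure_boxes A : boxes A -> out_measure A = in_measure A.
Proof.
move=> [_ [[m a] _ <-] [_ [[m' b] _ <-] <-]].
rewrite out_measureE in_measureE /=.
pose QA n v := ancestor d m n v == a.
pose QB n v := ancestor d m' n v == b.
have near_D k x : \forall n \near \oo, ancestor d k n (D n x) = D k x.
  by exists k => // n /= kn; rewrite (D_ancestor DP).
(* The approximations of the two sides by the [n]-th finite graph: they have equal mass by
   [card_mates], and each point is eventually classified correctly. *)
pose O r n := [set x | QA n (D n x) && QB n (mate d n (D n x, r)).1].
pose I r n := [set x | QA n (mate d n (D n x, r)).1 && QB n (D n x)].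
have limO : (\sum_(r < d) nu (O r n))%E @[n --> \oo] -->
    (\sum_(r < d) nu [set x | D m x = a /\ D m' (nb r x) = b])%E.
  apply: cvg_nnesum => r _.
    by apply: nearW => n; exact: measure_ge0.
  apply: probability_cvg.
  - move=> n; exact: (measurable_level n (fun v => QA n v && QB n (mate d n (v, r : nat)).1)).
  - have := measurable_out_edge r measurableT
      (measurableX (measurable_cyl m a) (measurable_cyl m' b)).
    by rewrite setTI.
  move=> x; apply: filterS2 (near_D m x) (nb_coord x m' (ltn_ord r)) => n e e'.
  rewrite /O /QA /QB /= e e'; split => [/andP[/eqP -> /eqP ->]//|[-> ->]].
  by rewrite !eqxx.
have limI : (\sum_(r < d) nu (I r n))%E @[n --> \oo] -->
    (\sum_(r < d) nu [set x | D m (nb r x) = a /\ D m' x = b])%E.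
  apply: cvg_nnesum => r _.
    by apply: nearW => n; exact: measure_ge0.
  apply: probability_cvg.
  - move=> n; exact: (measurable_level n (fun v => QA n (mate d n (v, r : nat)).1 && QB n v)).
  - have := measurable_in_edge r measurableT
      (measurableX (measurable_cyl m a) (measurable_cyl m' b)).
    by rewrite setTI.
  move=> x; apply: filterS2 (near_D m' x) (nb_coord x m (ltn_ord r)) => n e e'.
  rewrite /I /QA /QB /= e e'; split => [/andP[/eqP -> /eqP ->]//|[-> ->]].
  by rewrite !eqxx.
apply: cvg_unique limI => //; apply: cvg_trans limO; apply: near_eq_cvg; apply: nearW => n.
under eq_bigr => r _ do
  rewrite (prob_level n (fun v => QA n v && QB n (mate d n (v, r : nat)).1)).
under [in RHS]eq_bigr => r _ do
  rewrite (prob_level n (fun v => QA n (mate d n (v, r : nat)).1 && QB n v)).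
by rewrite !sumEFin -!mulr_suml -!natr_sum card_mates.
Qed.

Lemma out_measure_finite : (out_measure setT < +oo)%E.
Proof.
rewrite out_measureE; apply: lte_sum_pinfty => r _.
by rewrite (_ : [set _ | _] = setT) ?probability_setT ?ltry.
Qed.

Lemma out_measure_swap S : measurable S -> out_measure S = in_measure S.
Proof.
(* Pairs of stage-0 coordinates, enumerated by [unpickle], give the countable cover by boxes of
   finite measure that uniqueness requires. *)
apply: (measure_unique boxes (fun k => [set x | D 0 x = (odflt (0, 0)%N (choice.unpickle k)).1] `*`
  [set x | D 0 x = (odflt (0, 0)%N (choice.unpickle k)).2])).
- exact: measurable_boxes.
- move=> _ _ [A1 cA1 [B1 cB1 <-]] [A2 cA2 [B2 cB2 <-]].
  rewrite -setXI; exists (A1 `&` A2); first exact: cylinders_setI.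
  by exists (B1 `&` B2) => //; exact: cylinders_setI.
- move=> k; case: (odflt _ _) => i j /=.
  exists [set x | D 0 x = i]; first by exists (0%N, i).
  by exists [set x | D 0 x = j] => //; exists (0%N, j).
- apply/seteqP; split => // -[x y] _; exists (choice.pickle (D 0 x, D 0 y)) => //.
  by rewrite /= choice.pickleK.
- exact: out_measure_boxes.
move=> k; apply: le_lt_trans out_measure_finite.
apply: le_measure; rewrite ?inE //.
by apply: measurableX; exact: measurable_cyl.
Qed.

Lemma out_measure_setT : out_measure setT = d%:R%:E.
Proof.
rewrite out_measureE; under eq_bigr => r _ do
  rewrite (_ : [set _ | _] = setT) ?probability_setT //.
by rewrite sumEFin sumr_const card_ord.
Qed.

Lemma integral_out_measure (F : V * V -> \bar R) :
  measurable_fun setT F -> (forall p, 0 <= F p)%E ->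
  (\int[out_measure]_p F p = \sum_(r < d) \int[nu]_x F (x, nb r x))%E.
Proof.
move=> mF F0; rewrite /out_measure ge0_integral_measure_sum //.
by apply: eq_bigr => r _; rewrite ge0_integral_pushforward.
Qed.

Lemma mass_transport (F : V * V -> \bar R) :
  measurable_fun setT F -> (forall p, 0 <= F p)%E ->
  (\sum_(r < d) \int[nu]_x F (x, nb r x) = \sum_(r < d) \int[nu]_x F (nb r x, x))%E.
Proof.
move=> mF F0; rewrite -integral_out_measure //.
rewrite (eq_measure_integral in_measure); last by move=> S mS _; exact: out_measure_swap.
rewrite /in_measure ge0_integral_measure_sum //.
by apply: eq_bigr => r _; rewrite ge0_integral_pushforward.
Qed.

Lemma limit_edges_sym x y : E (x, y) <-> E (y, x).
Proof. by split; exact: (limit_edges_simple DP).2. Qed.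

Lemma xsection_limit_edges x : xsection E x = [set y | exists2 r, (r < d)%N & nb r x = y].
Proof.
by apply/seteqP; split => y; rewrite /xsection /= inE => h; apply/(limit_edgesE).
Qed.

Lemma ysection_limit_edges x : ysection E x = [set y | exists2 r, (r < d)%N & nb r x = y].
Proof.
apply/seteqP; split => y; rewrite /ysection /= inE.
  by move/limit_edges_sym/(limit_edgesE).
by move=> h; apply/limit_edges_sym/(limit_edgesE).
Qed.

Lemma deg_limit_edges (B : set V) x :
  deg R E B x = (\sum_(r < d) (\1_B (nb r x))%:E)%E.
Proof. by rewrite /deg xsection_limit_edges counting_image //; exact: nb_inj. Qed.

Lemma regular_limit_edges : regular R d E.
Proof.
move=> x; rewrite deg_limit_edges sumEFin; congr (_%:E).
by under eq_bigr do rewrite indicT; rewrite sumr_const card_ord.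
Qed.

Lemma measurable_limit_edges : measurable E.
Proof.
(* A union of graphs of the maps [nb r], each cut out by the equality of all coordinates. *)
rewrite (_ : E = \bigcup_(r in [set r | (r < d)%N]) \bigcap_n \bigcup_c
    ((nb r @^-1` [set y | D n y = c]) `*` [set y | D n y = c])).
  apply: bigcup_measurable => r _; apply: bigcapT_measurable => n.
  apply: bigcupT_measurable => c; apply: measurableX; last exact: measurable_cyl.
  by rewrite -[_ @^-1` _]setTI; apply: measurable_nb => //; exact: measurable_cyl.
apply/seteqP; split => -[x y] /=.
  move=> /(limit_edgesE)[r rd <-]; exists r => // n _.
  by exists (D n (nb r x)).
move=> [r /= rd h]; apply/(limit_edgesE); exists r => //.
apply: (coord_inj DP); apply: nearW => n.
by have [c _ [/= -> ->]] := h n I.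
Qed.

Lemma measurable_out r S : measurable S -> measurable [set x | S (x, nb r x)].
Proof.
by move=> mS; have := measurable_out_edge r measurableT mS; rewrite setTI.
Qed.

Lemma measurable_in r S : measurable S -> measurable [set x | S (nb r x, x)].
Proof.
by move=> mS; have := measurable_in_edge r measurableT mS; rewrite setTI.
Qed.

Lemma integral_deg (A B : set V) : measurable A -> measurable B ->
  (\int[nu]_(x in A) deg R E B x = out_measure (A `*` B))%E.
Proof.
move=> mA mB.
have mnb r : measurable (nb r @^-1` B).
  by rewrite -[_ @^-1` _]setTI; exact: measurable_nb.
under eq_integral => x _ do rewrite deg_limit_edges.
rewrite ge0_integral_sum //; last first.
  move=> r; apply/measurable_EFinP; apply: measurableT_comp; last first.
    exact: measurable_funTS (measurable_nb r).
  exact: measurable_indic.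
rewrite out_measureE; apply: eq_bigr => r _.
rewrite (eq_integral (fun x => (\1_(nb r @^-1` B) x)%:E)); last first.
  by move=> x _; rewrite !indicE; congr (_%:R%:E); congr nat_of_bool; apply/idP/idP; rewrite !inE.
by rewrite integral_indic // setIC; congr (nu _).
Qed.

Lemma graphing_limit_edges : graphing nu E.
Proof.
split.
- exact: measurable_limit_edges.
- exact: limit_edges_simple DP.
move=> A B mA mB; rewrite !integral_deg //.
rewrite (out_measure_swap); last exact: measurableX.
by rewrite out_measureE in_measureE; apply: eq_bigr => r _; congr (nu _);
  apply/seteqP; split => x [].
Qed.

Lemma treeing_limit_edges : treeing nu E.
Proof.
split; first exact: graphing_limit_edges.
exists set0; split => //.
by move=> x [p [c [_ _ c3]]]; exact: limit_edges_acyclic DP _ c3.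
Qed.

Lemma measurable_side b : measurable [set x | side D x = b].
Proof.
rewrite (_ : [set x | _] = [set x | (0 < D 0 x)%N == b]).
  exact: (measurable_level 0 (fun v => (0 < v)%N == b)).
by apply/seteqP; split => x; rewrite /side /=; [move=> -> | move=> /eqP].
Qed.

Lemma bipartite_limit_edges : measurably_bipartite E.
Proof.
exists [set x | side D x = false], [set x | side D x = true]; split.
- exact: measurable_side.
- exact: measurable_side.
- by apply/seteqP; split => // x _; rewrite /=; case: (side D x); [right | left].
- by apply/seteqP; split => // x [/= ->].
move=> x y /(limit_edges_side DP) /=; case: (side D x) => /= ->; first by right.
by left.
Qed.

Lemma dir_deg_limit_edges (S : set (V * V)) x :
  dir_deg R (S `&` E) x =
  ((2^-1)%:E * (\sum_(r < d) (\1_S (x, nb r x))%:E + \sum_(r < d) (\1_S (nb r x, x))%:E))%E.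
Proof.
rewrite /dir_deg; congr (_ * (_ + _))%E.
  rewrite (_ : xsection _ x = [set y | exists2 r, (r < d)%N & nb r x = y] `&` xsection S x).
    rewrite counting_image; last exact: nb_inj.
    by apply: eq_bigr => r _; rewrite !indicE; congr (_%:R%:E); rewrite mem_xsection.
  by rewrite -xsection_limit_edges -xsectionI setIC.
rewrite (_ : ysection _ x = [set y | exists2 r, (r < d)%N & nb r x = y] `&` ysection S x).
  rewrite counting_image; last exact: nb_inj.
  by apply: eq_bigr => r _; rewrite !indicE; congr (_%:R%:E); rewrite mem_ysection.
by rewrite -ysection_limit_edges -ysectionI setIC.
Qed.

(** The outgoing and incoming counts in [dir_deg] have equal integrals by mass transport, so its
    averaging factor cancels and only the outer 1/2 remains. *)
Lemma edge_measure_limit_edges S : measurable S ->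
  edge_measure nu E S = ((2^-1)%:E * out_measure S)%E.
Proof.
move=> mS; rewrite /edge_measure; congr (_ * _)%E.
under eq_integral => x _ do rewrite dir_deg_limit_edges.
have mI : measurable_fun [set: V * V] (\1_S : V * V -> R) by exact: measurable_indic.
have mo (r : 'I_d) : measurable_fun setT (fun x => (\1_S (x, nb r x))%:E : \bar R).
  have := measurableT_comp mI (measurable_out_edge r).
  by move=> h; apply/measurable_EFinP.
have mi (r : 'I_d) : measurable_fun setT (fun x => (\1_S (nb r x, x))%:E : \bar R).
  have := measurableT_comp mI (measurable_in_edge r).
  by move=> h; apply/measurable_EFinP.
rewrite ge0_integralZl_EFin //; last first.
- by apply: emeasurable_funD; exact: emeasurable_sum.
- by move=> x _; apply: adde_ge0; apply: sume_ge0.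
rewrite ge0_integralD //; try (by move=> x _; apply: sume_ge0); try exact: emeasurable_sum.
rewrite !ge0_integral_sum //.
have -> : (\sum_(r < d) \int[nu]_x (\1_S (nb r x, x))%:E =
           \sum_(r < d) \int[nu]_x (\1_S (x, nb r x))%:E)%E.
  apply/esym/(mass_transport (F := fun p => (\1_S p)%:E)) => //.
  by apply/measurable_EFinP; exact: measurable_indic.
have -> : (\sum_(r < d) \int[nu]_x (\1_S (x, nb r x))%:E = out_measure S)%E.
  rewrite out_measureE; apply: eq_bigr => r _.
  rewrite (eq_integral (fun x => (\1_[set x | S (x, nb r x)] x)%:E)); last first.
    by move=> x _; rewrite !indicE; congr (_%:R%:E); congr nat_of_bool; apply/idP/idP; rewrite !inE.
  by rewrite integral_indic ?setIT //; exact: measurable_out.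
by rewrite -mule2n -mule_natl muleA -EFinM mulVf ?mul1e // pnatr_eq0.
Qed.

(** * Mass transport for signed integrable functions *)

Section Signed.
Variable F : V * V -> R.
Hypothesis mF : measurable_fun setT F.

Lemma measurable_comp_out r : measurable_fun setT (fun x => F (x, nb r x)).
Proof. exact: measurableT_comp mF (measurable_out_edge r). Qed.

Lemma measurable_comp_in r : measurable_fun setT (fun x => F (nb r x, x)).
Proof. exact: measurableT_comp mF (measurable_in_edge r). Qed.

Hypothesis iF : (\int[out_measure]_p `|F p|%:E < +oo)%E.

Let mabs : measurable_fun setT (fun p => `|F p|%:E).
Proof. by apply/measurable_EFinP; exact: measurableT_comp. Qed.

Let abs_out : (\sum_(r < d) \int[nu]_x `|F (x, nb r x)|%:E < +oo)%E.
Proof. by rewrite -(integral_out_measure (F := fun p => `|F p|%:E)) // => p; rewrite lee_fin. Qed.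

Lemma integrable_out r : (r < d)%N -> nu.-integrable setT (fun x => (F (x, nb r x))%:E).
Proof.
move=> rd; apply/integrableP; split; first by apply/measurable_EFinP; exact: measurable_comp_out.
apply: le_lt_trans abs_out; rewrite (bigD1 (Ordinal rd)) //=.
by rewrite leeDl // sume_ge0 // => i _; apply: integral_ge0 => x _; rewrite lee_fin.
Qed.

Lemma integrable_in r : (r < d)%N -> nu.-integrable setT (fun x => (F (nb r x, x))%:E).
Proof.
move=> rd; apply/integrableP; split; first by apply/measurable_EFinP; exact: measurable_comp_in.
move: abs_out.
rewrite (mass_transport (F := fun p => `|F p|%:E)) //.
apply: le_lt_trans; rewrite (bigD1 (Ordinal rd)) //=.
by rewrite leeDl // sume_ge0 // => i _; apply: integral_ge0 => x _; rewrite lee_fin.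
Qed.

End Signed.

Lemma signed_mass_transport (F : V * V -> R) :
  measurable_fun setT F -> (\int[out_measure]_p `|F p|%:E < +oo)%E ->
  (\int[nu]_x (\sum_(r < d) (F (x, nb r x))%:E) =
   \int[nu]_x (\sum_(r < d) (F (nb r x, x))%:E))%E.
Proof.
move=> mF iF.
pose Fp p := Num.max (F p) 0; pose Fm p := Num.max (- F p) 0.
have Fpm p : F p = Fp p - Fm p.
  rewrite /Fp /Fm; case: (leP (F p) 0) => h; case: (leP (- F p) 0) => h'; lra.
have Fp0 p : 0 <= Fp p by rewrite /Fp le_max lexx orbT.
have Fm0 p : 0 <= Fm p by rewrite /Fm le_max lexx orbT.
have mFp : measurable_fun setT Fp by exact: measurable_maxr.
have mFm : measurable_fun setT Fm by apply: measurable_maxr => //; exact: measurableT_comp.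
have abs_le (G : V * V -> R) : measurable_fun setT G -> (forall p, 0 <= G p) ->
    (forall p, G p <= `|F p|) -> (\int[out_measure]_p `|G p|%:E < +oo)%E.
  move=> mG G0 GF; apply: le_lt_trans iF; apply: ge0_le_integral => //.
  - by apply/measurable_EFinP; exact: measurableT_comp.
  - by apply/measurable_EFinP; exact: measurableT_comp.
  - by move=> p _; rewrite lee_fin ger0_norm.
have iFp : (\int[out_measure]_p `|Fp p|%:E < +oo)%E.
  by apply: abs_le => // p; rewrite /Fp ge_max normr_ge0 ler_norm.
have iFm : (\int[out_measure]_p `|Fm p|%:E < +oo)%E.
  by apply: abs_le => // p; rewrite /Fm ge_max normr_ge0 -normrN ler_norm.
have split (e : nat -> V -> V * V) :
    (forall r : 'I_d, nu.-integrable setT (fun x => (Fp (e r x))%:E)) ->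
    (forall r : 'I_d, nu.-integrable setT (fun x => (Fm (e r x))%:E)) ->
    (\int[nu]_x (\sum_(r < d) (F (e r x))%:E) =
     \sum_(r < d) \int[nu]_x (Fp (e r x))%:E - \sum_(r < d) \int[nu]_x (Fm (e r x))%:E)%E.
  move=> ip im; rewrite -!integral_sum // -integralB //; try exact: integrable_sum.
  apply: eq_integral => x _; rewrite !sumEFin -EFinB -sumrB.
  by congr (_%:E); apply: eq_bigr => r _; rewrite Fpm.
rewrite (split (out_edge)); try by move=> r; exact: integrable_out.
rewrite (split (in_edge)); try by move=> r; exact: integrable_in.
have MT (G : V * V -> R) : measurable_fun setT G -> (forall p, 0 <= G p) ->
    (\sum_(r < d) \int[nu]_x (G (out_edge r x))%:E =
     \sum_(r < d) \int[nu]_x (G (in_edge r x))%:E)%E.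
  move=> mG G0; apply: (mass_transport (F := fun p => (G p)%:E)).
    exact/measurable_EFinP.
  by move=> p; rewrite lee_fin.
by rewrite !MT.
Qed.

(** As a factor in integrals, it makes every undirected edge count once, from its A-end. *)
Definition source (x : V) : R := (~~ side D x)%:R.

Lemma measurable_source : measurable_fun setT source.
Proof.
rewrite (_ : source = \1_[set x | side D x = false]).
  by apply: measurable_indic; exact: measurable_side _.
apply/funext => x; rewrite /source indicE; case E: (side D x).
  by rewrite memNset //= E.
by rewrite mem_set.
Qed.

Lemma source_nb r x : (r < d)%N -> source (nb r x) = 1 - source x.
Proof.
move=> rd; have [s /(linked_side DP rd) sxy] := nbP x rd.
by rewrite /source sxy negbK; case: (side D x); rewrite ?subr0 ?subrr.
Qed.

Lemma source_norm x : `|source x| <= 1.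
Proof. by rewrite /source; case: (side D x); rewrite /= ?normr0 ?normr1. Qed.

(** * Borel representatives of integrable circulations vanish almost everywhere *)

Section Vanishing.
Variable g : V * V -> R.
Hypothesis mg : measurable_fun setT g.
Hypothesis ig : (\int[out_measure]_p `|g p|%:E < +oo)%E.
Hypothesis g_sum : \forall x \ae nu, \sum_(r < d) g (x, nb r x) = 0.
Hypothesis g_anti : \forall x \ae nu, forall r, (r < d)%N -> g (nb r x, x) = - g (x, nb r x).

Lemma integrable_scaled (h : V * V -> R) (C : R) :
  measurable_fun setT h -> (forall p, `|h p| <= C) ->
  (\int[out_measure]_p `|g p * h p|%:E < +oo)%E.
Proof.
move=> mh hC.
have C0 : 0 <= C by apply: le_trans (normr_ge0 (h point)) (hC point).
apply: (@le_lt_trans _ _ (\int[out_measure]_p (C%:E * `|g p|%:E))%E).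
  apply: ge0_le_integral => //.
  - by apply/measurable_EFinP/measurableT_comp => //; exact: measurable_funM.
  - by apply: measurable_funeM; apply/measurable_EFinP; exact: measurableT_comp.
  by move=> p _; rewrite -EFinM lee_fin normrM mulrC ler_wpM2r.
rewrite ge0_integralZl_EFin //; last first.
  by apply/measurable_EFinP; exact: measurableT_comp.
by rewrite lte_mul_pinfty // lee_fin.
Qed.

(** Mass transport moves the term with [u (nb r x)] to the other end of the edge. Both terms then
    become the divergence of [g] at [x] times a factor depending on [x] alone, hence vanish. *)
Lemma coboundary_orthogonal (u : V -> R) (C : R) :
  measurable_fun setT u -> (forall x, `|u x| <= C) ->
  (\int[nu]_x (\sum_(r < d) g (x, nb r x) * (source x * (u (nb r x) - u x)))%:E = 0)%E.
Proof.
move=> mu uC.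
have C0 : 0 <= C by apply: le_trans (normr_ge0 (u point)) (uC point).
pose F1 (p : V * V) := g p * (source p.1 * u p.2).
pose F2 (p : V * V) := g p * (source p.1 * u p.1).
have ms := measurable_source.
have m1 : measurable_fun setT (fun p : V * V => source p.1 * u p.2).
  by apply: measurable_funM; apply: measurableT_comp.
have m2 : measurable_fun setT (fun p : V * V => source p.1 * u p.1).
  by apply: measurable_funM; apply: measurableT_comp.
have iF1 : (\int[out_measure]_p `|F1 p|%:E < +oo)%E.
  apply: (integrable_scaled (C := C) m1) => p; rewrite normrM -[C]mul1r.
  by rewrite ler_pM // source_norm.
have iF2 : (\int[out_measure]_p `|F2 p|%:E < +oo)%E.
  apply: (integrable_scaled (C := C) m2) => p; rewrite normrM -[C]mul1r.
  by rewrite ler_pM // source_norm.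
have mF1 : measurable_fun setT F1 by exact: measurable_funM.
have mF2 : measurable_fun setT F2 by exact: measurable_funM.
have mo1 : measurable_fun setT (fun x => \sum_(r < d) F1 (x, nb r x)).
  by apply: measurable_sum => r; exact: measurable_comp_out.
have mo2 : measurable_fun setT (fun x => \sum_(r < d) F2 (x, nb r x)).
  by apply: measurable_sum => r; exact: measurable_comp_out.
have mi1 : measurable_fun setT (fun x => \sum_(r < d) F1 (nb r x, x)).
  by apply: measurable_sum => r; exact: measurable_comp_in.
have int1 : nu.-integrable setT (fun x => (\sum_(r < d) F1 (x, nb r x))%:E).
  under eq_fun do rewrite -sumEFin.
  by apply: integrable_sum => // r _; exact: (integrable_out mF1 iF1).
have int2 : nu.-integrable setT (fun x => (\sum_(r < d) F2 (x, nb r x))%:E).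
  under eq_fun do rewrite -sumEFin.
  by apply: integrable_sum => // r _; exact: (integrable_out mF2 iF2).
have zero1 : (\int[nu]_x (\sum_(r < d) F1 (x, nb r x))%:E = 0)%E.
  under eq_integral do rewrite -sumEFin.
  rewrite (signed_mass_transport mF1 iF1).
  under eq_integral do rewrite sumEFin.
  rewrite (ae_eq_integral (cst 0%E)) ?integral0 //; first exact/measurable_EFinP.
  apply: filterS2 g_sum g_anti => x sx ax _ /=; congr (_%:E).
  rewrite /F1 /=; under eq_bigr => r _ do rewrite ax // source_nb // mulNr.
  by rewrite sumrN -mulr_suml sx mul0r oppr0.
have zero2 : (\int[nu]_x (\sum_(r < d) F2 (x, nb r x))%:E = 0)%E.
  rewrite (ae_eq_integral (cst 0%E)) ?integral0 //; first exact/measurable_EFinP.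
  apply: filterS g_sum => x sx _ /=; congr (_%:E).
  by rewrite /F2 /= -mulr_suml sx mul0r.
transitivity (\int[nu]_x ((\sum_(r < d) F1 (x, nb r x))%:E - (\sum_(r < d) F2 (x, nb r x))%:E))%E.
  apply: eq_integral => x _; rewrite -EFinB -sumrB; congr (_%:E).
  by apply: eq_bigr => r _; rewrite /F1 /F2 /=; ring.
by rewrite integralB_EFin // zero1 zero2 sube0.
Qed.

Lemma measurable_comp_coord n (h : nat -> R) : measurable_fun setT (h \o D n).
Proof.
move=> _ Y mY; rewrite setTI.
rewrite (_ : _ @^-1` _ = [set x | `[< Y (h (D n x)) >]]).
  exact: (measurable_level n (fun v => `[< Y (h v) >])).
by apply/seteqP; split => x /= /asboolP.
Qed.

Lemma measurable_potential n : measurable_fun setT (fun x => (potential d D n x)%:R : R).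
Proof.
pose h v := height d (top n) (marked d (mate d n) n) (width d n.+1 <= v)%N v.
rewrite (_ : (fun _ => _) = (fun v => (h v)%:R) \o D n.+1).
  exact: measurable_comp_coord.
by apply/funext => x; rewrite /h /potential /= leqNgt (D_side DP) negbK.
Qed.

Lemma potential_le n x : (potential d D n x <= (top n).+1)%N.
Proof.
have := level_le (top n) (label_gt0 DP) (D n.+1 x).
rewrite /potential /height; move: (level _ _ _) => l lt.
by case: (side D x); case: ifP => _ //; [rewrite (leq_trans (leq_subr _ _)) | rewrite leqW].
Qed.

Lemma source_potential_le n r x : (r < d)%N ->
  `|source x * ((potential d D n (nb r x))%:R - (potential d D n x)%:R)| <= 1.
Proof.
move=> rd; rewrite /source; have [sx|sx] := boolP (side D x).
  by rewrite mul0r normr0.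
have [s xs] := nbP x rd.
have /andP[lo hi] := potential_linked DP n rd sx xs.
rewrite mul1r -natrB // normr_nat (_ : 1 = 1%:R) // ler_nat.
by rewrite leq_subLR addn1.
Qed.

Lemma label_integral_eq0 m a r0 : (r0 < d)%N ->
  (\int[nu]_x (g (x, nb r0 x) * (source x * (D m x == a)%:R))%:E = 0)%E.
Proof.
move=> r0d.
have freq k : exists n, (k <= n)%N /\ code n = (m, a, r0).
  by have [n kn cn] := code_unbounded (m, a, r0) k; exists n.
(* A sequence of stages tending to infinity, all of which mark the same cylinder and label. *)
have [N NP] := choice freq.
pose u k x : R := (potential d D (N k) x)%:R.
pose G k x := \sum_(r < d) g (x, nb r x) * (source x * (u k (nb r x) - u k x)).
pose G' x := g (x, nb r0 x) * (source x * (D m x == a)%:R).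
pose B x := \sum_(r < d) `|g (x, nb r x)|.
have ms := measurable_source.
have mo r : measurable_fun setT (fun x => g (x, nb r x)) by exact: measurable_comp_out.
have mu k : measurable_fun setT (u k) by exact: measurable_potential.
have mG k : measurable_fun setT (G k).
  apply: measurable_sum => r; apply: measurable_funM => //.
  apply: measurable_funM => //; apply: measurable_funB => //.
  by apply: measurableT_comp => //; exact: measurable_nb.
have mG' : measurable_fun setT G'.
  apply: measurable_funM => //; apply: measurable_funM => //.
  exact: (measurable_comp_coord m (fun v => (v == a)%:R)).
have G0 k : (\int[nu]_x (G k x)%:E = 0)%E.
  apply: (coboundary_orthogonal (C := (top (N k)).+1%:R)) => // x.
  by rewrite /u normr_nat ler_nat potential_le.
(* The potentials are bounded only stage by stage, but their increments are at most 1 uniformly in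
   [k]. *)
have GB k x : `|G k x| <= B x.
  apply: le_trans (ler_norm_sum _ _ _) _; apply: ler_sum => r _.
  rewrite normrM -[leRHS]mulr1 ler_wpM2l //.
  exact: source_potential_le.
(* On side A the increments eventually are the indicator of the marked edges, so only the label [r0]
   survives; on side B both members are 0. *)
have limG x : \forall k \near \oo, G k x = G' x.
  rewrite /G /G'; have [sx|sx] := boolP (side D x).
    apply: nearW => k; rewrite /source sx /= !mul0r mulr0 big1 // => r _.
    by rewrite mul0r mulr0.
  have nearN (Q : nat -> Prop) : (\forall n \near \oo, Q n) -> \forall k \near \oo, Q (N k).
    move=> [n0 _ h]; exists n0 => // k /= n0k; apply: h => /=.
    by apply: leq_trans n0k _; case: (NP k).
  have : \forall k \near \oo, forall r : 'I_d,
      u k (nb r x) - u k x = ((D m x == a) && (r == r0 :> nat))%:R.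
    apply: filter_forall => r; have [s xs] := nbP x (ltn_ord r).
    have h1 := nearN _ (linked_depth DP m a r0 (ltn_ord r) sx xs).
    have h2 := nearN _ (potential_depth DP x).
    have h3 := nearN _ (potential_depth DP (nb r x)).
    apply: filterS3 h1 h2 h3 => k e1 e2 e3.
    by rewrite /u e2 e3 (e1 (NP k).2) natrD addrAC subrr add0r.
  apply: filterS => k e; rewrite (bigD1 (Ordinal r0d)) // e /= eqxx andbT.
  rewrite big1 ?addr0 // => r neq; rewrite e.
  by rewrite (_ : (r == r0 :> nat) = false) ?andbF ?mulr0 //; apply/negbTE.
have intB : nu.-integrable setT (fun x => (B x)%:E).
  rewrite /B; under eq_fun do rewrite -sumEFin.
  apply: integrable_sum => // r _.
  exact: (integrable_abse (integrable_out mg ig (ltn_ord r))).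
have [] := @dominated_convergence _ _ _ nu setT measurableT (fun k x => (G k x)%:E)
  (fun x => (G' x)%:E) (fun x => (B x)%:E).
- by move=> k; exact/measurable_EFinP.
- exact/measurable_EFinP.
- by apply: aeW => x _; apply: cvg_near_cst; apply: filterS (limG x) => k ->.
- exact: intB.
- by apply: aeW => x k _; rewrite lee_fin GB.
move=> _ _ cvgG; apply/esym; apply: cvg_unique cvgG => //.
by apply: cvg_near_cst; apply: nearW => k /=; rewrite G0.
Qed.

Lemma source_flow_eq0 r : (r < d)%N -> \forall x \ae nu, g (x, nb r x) * source x = 0.
Proof.
move=> rd.
pose f x := g (x, nb r x) * source x.
have mf : measurable_fun setT f.
  by apply: measurable_funM; [exact: measurable_comp_out | exact: measurable_source].
have intf : nu.-integrable setT (EFin \o f).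
  apply: le_integrable (integrable_out mg ig rd) => //; first exact/measurable_EFinP.
  move=> x _; rewrite /= lee_fin normrM -[leRHS]mulr1 ler_wpM2l //.
  exact: source_norm.
have cyl n c : (\int[nu]_(x in [set x | D n x = c]) (f x)%:E = 0)%E.
  rewrite integral_mkcond -[RHS](label_integral_eq0 n c rd).
  apply: eq_integral => x _; rewrite patchE /f.
  have [xc|xc] := eqVneq (D n x) c; first by rewrite mem_set // mulr1.
  by rewrite memNset ?mulr0 //; exact/eqP.
have fT : (\int[nu]_x (f x)%:E = 0)%E.
  have cov : setT = \bigcup_k [set x | D 0 x = k] by rewrite cylinders_cover.
  have -> : (\int[nu]_x (f x)%:E = \int[nu]_(x in \bigcup_k [set x | D 0 x = k]) (f x)%:E)%E.
    by rewrite -cov.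
  rewrite integral_bigcup.
  - by rewrite eseries0.
  - apply/trivIsetP => i j _ _ neq; apply/seteqP; split => // x [/= -> e].
    by move: neq; rewrite e eqxx.
  - by move=> k; exact: measurable_cyl.
  - by rewrite -cov.
have cylf A : cylinders D A -> (\int[nu]_(x in A) (f x)%:E = 0)%E.
  by move=> [[n c] _ <-]; exact: cyl.
have := integral_generator_eq0 D_gen (cylinders_setI) intf fT cylf.
by apply: filterS => x /(_ I) [].
Qed.

(** [source_flow_eq0] settles the edges leaving side A. Mass transport of [|g|] shows that they also
    vanish when seen from almost every B-end, and antisymmetry turns them around. *)
Lemma flow_eq0 : \forall x \ae nu, forall r, (r < d)%N -> g (x, nb r x) = 0.
Proof.
suff flow r : \forall x \ae nu, (r < d)%N -> g (x, nb r x) = 0 by exact: ae_foralln.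
have [rd|rd] := ltnP r d; last exact: aeW.
pose F (p : V * V) : \bar R := (`|g p| * source p.1)%:E.
have mabsg : measurable_fun setT (fun p => `|g p|) by exact: measurableT_comp.
have mF : measurable_fun setT F.
  apply/measurable_EFinP; apply: measurable_funM => //.
  by apply: measurableT_comp => //; exact: measurable_source.
have F0 p : (0 <= F p)%E by rewrite lee_fin mulr_ge0 // /source ler0n.
have mF_in s : measurable_fun setT (fun x => F (nb s x, x)).
  exact: measurableT_comp mF (measurable_in_edge s).
have mF_out s : measurable_fun setT (fun x => F (x, nb s x)).
  exact: measurableT_comp mF (measurable_out_edge s).
have out0 : (\sum_(s < d) \int[nu]_x F (x, nb s x) = 0)%E.
  apply: big1 => s _.
  rewrite (ae_eq_integral (cst 0%E)) ?integral0 //.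
  apply: filterS (source_flow_eq0 (ltn_ord s)) => x gx _ /=.
  rewrite /F /=; congr (_%:E); move/eqP: gx; rewrite mulf_eq0 => /orP[/eqP ->|/eqP ->].
    by rewrite normr0 mul0r.
  by rewrite mulr0.
have int0 : (\int[nu]_x F (nb r x, x) = 0)%E.
  apply/eqP; rewrite eq_le integral_ge0 // andbT.
  rewrite -out0 (mass_transport mF F0) (bigD1 (Ordinal rd)) //=.
  by rewrite leeDl // sume_ge0 // => s _; exact: integral_ge0.
have /ae_eq_integral_abs : (\int[nu]_x `|F (nb r x, x)| = 0)%E.
  by rewrite -[RHS]int0; apply: eq_integral => x _; rewrite gee0_abs.
move=> /(_ measurableT (mF_in r)) Fin0.
apply: filterS3 Fin0 g_anti (source_flow_eq0 rd) => x Fx ax sx _.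
have := Fx I; rewrite /F /= ax // normrN source_nb // => -[] /eqP.
rewrite mulf_eq0 normr_eq0 => /orP[/eqP //|/eqP s1].
by move: sx; rewrite (_ : source x = 1) ?mulr1 //; lra.
Qed.

Lemma support_null : out_measure [set p | g p != 0] = 0%E.
Proof.
rewrite out_measureE big1 // => r _.
have mS := measurable_support mg.
apply: measure_negligible; first exact: (measurable_out r mS).
by move: flow_eq0; apply: negligibleS => x /= gx /(_ r (ltn_ord r)) /eqP; apply/negP.
Qed.

End Vanishing.

(** * Circulations and perfect matchings measurable for the completion *)

Lemma edge_measure_eq0 S : measurable S -> edge_measure nu E S = 0%E <-> out_measure S = 0%E.
Proof.
move=> mS; rewrite (edge_measure_limit_edges mS).
split => [/eqP|->]; last by rewrite mule0.
by rewrite mule_eq0 => /orP[|/eqP //]; rewrite eqe invr_eq0 pnatr_eq0.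
Qed.

Lemma integral_edge_measure (f : V * V -> \bar R) :
  measurable_fun setT f -> (forall p, 0 <= f p)%E ->
  (\int[edge_measure nu E]_p f p = (2^-1)%:E * \int[out_measure]_p f p)%E.
Proof.
move=> mf f0; have h0 : 0 <= 2^-1 :> R by rewrite invr_ge0.
pose h := NngNum h0.
rewrite (@eq_set_function_integral _ _ _ _ (mscale h out_measure)).
  by rewrite ge0_integral_mscale.
by move=> S mS; rewrite (edge_measure_limit_edges mS).
Qed.

Lemma sum_neighbours (phi : V * V -> R) x :
  (forall x y, ~ E (x, y) -> phi (x, y) = 0) ->
  \sum_(y \in [set: V]) phi (x, y) = \sum_(r < d) phi (x, nb r x).
Proof.
move=> supp.
rewrite -(fsbig_widen [set nb r x | r in `I_d] setT) //; last first.
  move=> y [_ ny] /=; apply: supp => /(limit_edgesE)[r rd e].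
  by apply: ny; exists r.
rewrite fsbig_image ?(fsbig_ord _ d (fun r => phi (x, nb r x))) //.
by move=> r r'; rewrite !inE => rd r'd; exact: nb_inj.
Qed.

Lemma circulation_negligible (phi : V * V -> R) :
  L1as nu E phi -> circulation phi ->
  (edge_measure nu E).-negligible [set e | phi e != 0].
Proof.
move=> [[g /integrableP[mg ig] [N [mN /(edge_measure_eq0 mN) N0 sub]]] supp anti] circ.
have {}mg : measurable_fun setT g by exact/measurable_EFinP.
have {}ig : (\int[out_measure]_p `|g p|%:E < +oo)%E.
  move: ig; rewrite integral_edge_measure //; last first.
    by apply: measurableT_comp => //; exact/measurable_EFinP.
  have : (0 <= \int[out_measure]_p `|g p|%:E)%E.
    by apply: integral_ge0 => p _; rewrite lee_fin.
  rewrite -[X in (_ * X)%E]/(\int[out_measure]_p `|g p|%:E)%E.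
  case: (\int[out_measure]_p _)%E => [r _ _|_|] //=; first by rewrite ltry.
  by rewrite gt0_muley // lte_fin invr_gt0.
have good p : ~ N p -> phi p = g p.
  by move=> Np; apply: contrapT => /eqP neq; apply: Np; exact: sub.
(* A null set of edges misses all edges at almost every vertex, in both directions; so the
   representative [g] inherits the circulation property and antisymmetry almost everywhere. *)
have off_out : \forall x \ae nu, forall r, (r < d)%N -> ~ N (x, nb r x).
  suff off r : \forall x \ae nu, (r < d)%N -> ~ N (x, nb r x) by exact: ae_foralln.
  have [rd|rd] := ltnP r d; last exact: aeW.
  exists [set x | N (x, nb r x)]; split; first exact: (measurable_out).
    apply/eqP; rewrite -measure_le0 -N0 out_measureE (bigD1 (Ordinal rd)) //=.
    by rewrite leeDl // sume_ge0.
  by move=> x /= h; apply: contrapT => nN; apply: h.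
have off_in : \forall x \ae nu, forall r, (r < d)%N -> ~ N (nb r x, x).
  suff off r : \forall x \ae nu, (r < d)%N -> ~ N (nb r x, x) by exact: ae_foralln.
  have [rd|rd] := ltnP r d; last exact: aeW.
  exists [set x | N (nb r x, x)]; split; first exact: (measurable_in).
    apply/eqP; rewrite -measure_le0 -N0 (out_measure_swap mN).
    rewrite in_measureE (bigD1 (Ordinal rd)) //=.
    by rewrite leeDl // sume_ge0.
  by move=> x /= h; apply: contrapT => nN; apply: h.
have g_sum : \forall x \ae nu, \sum_(r < d) g (x, nb r x) = 0.
  apply: filterS off_out => x ox; rewrite -[RHS](circ x) sum_neighbours //.
  by apply: eq_bigr => r _; rewrite good //; exact: ox.
have g_anti : \forall x \ae nu, forall r, (r < d)%N -> g (nb r x, x) = - g (x, nb r x).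
  apply: filterS2 off_out off_in => x ox ix r rd.
  by rewrite -(good _ (ox r rd)) -(good _ (ix r rd)); exact: anti.
have mS := measurable_support mg.
exists ([set p | g p != 0] `|` N); split; first exact: measurableU.
  apply/edge_measure_eq0; first exact: measurableU.
  by apply: null_set_setU => //; exact: (support_null mg ig g_sum g_anti).
move=> p /= pn; have [Np|Np] := pselect (N p); [by right | left].
by rewrite -good.
Qed.

Lemma limit_edges_nonnull N : E `<=` N -> measurable N -> edge_measure nu E N = 0%E -> (d = 0)%N.
Proof.
move=> EN mN /(edge_measure_eq0 mN); rewrite out_measureE.
under eq_bigr => r _.
  rewrite (_ : [set x | N (x, nb r x)] = setT) ?probability_setT; last first.
    apply/seteqP; split => // x _; apply: EN; apply/(limit_edgesE).
    by exists r.
  over.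
by rewrite sumEFin sumr_const card_ord => -[] /eqP; rewrite pnatr_eq0 => /eqP.
Qed.

(** The sign given by the side of the tail makes the flow antisymmetric; at each vertex its sum is
    [d - d = 0] up to sign. *)
Definition matching_flow (M : set (V * V)) (p : V * V) : R :=
  \1_E p * ((-1) ^+ side D p.1 * (d%:R * \1_M p - 1)).

Lemma no_perfect_matching : (2 <= d)%N ->
  ~ (exists M : set (V * V), measurable_perfect_matching nu E M).
Proof.
move=> d2 [M [[M0 mM0 [N negN MN]] ME Msym Mex]].
have EE r x : (r < d)%N -> E (x, nb r x).
  by move=> rd; apply/(limit_edgesE); exists r.
have mE : measurable E := measurable_limit_edges.
have msgn : measurable_fun setT (fun p : V * V => (-1) ^+ side D p.1 : R).
  rewrite (_ : (fun _ => _) = (fun p : V * V => 2 * source p.1 - 1)).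
    apply: measurable_funB => //; apply: measurable_funM => //.
    by apply: measurableT_comp => //; exact: measurable_source.
  apply/funext => p; rewrite /source; case: (side D p.1) => /=; first by rewrite expr1; ring.
  by rewrite expr0; ring.
have sgn_norm x : `|(-1) ^+ side D x : R| = 1 by rewrite normrX normrN1 expr1n.
have mflow : measurable_fun setT (matching_flow M0).
  apply: measurable_funM; first exact: measurable_indic.
  apply: measurable_funM => //; apply: measurable_funB => //.
  by apply: measurable_funM => //; exact: measurable_indic.
have : L1as nu E (matching_flow M) /\ circulation (matching_flow M).
  split; first split.
  (* [M] is the union of the Borel set [M0] and a negligible set, so the flow of [M0] is a Borel
     representative, bounded by [d.+1]. *)
  - exists (matching_flow M0).
      apply/integrableP; split; first exact/measurable_EFinP.
      rewrite integral_edge_measure //; last first.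
        by apply: measurableT_comp => //; exact/measurable_EFinP.
      apply: (@le_lt_trans _ _ ((2^-1)%:E * \int[out_measure]_p (d.+1%:R)%:E)%E).
        rewrite lee_pmul2l ?lte_fin ?invr_gt0 //.
        apply: ge0_le_integral => //.
          by apply: measurableT_comp => //; exact/measurable_EFinP.
        move=> p _; rewrite lee_fin /matching_flow normrM normrM sgn_norm mul1r.
        rewrite -[leRHS]mul1r ler_pM //.
          by rewrite indicE; case: (_ \in _); rewrite ?normr1 ?normr0.
        rewrite (le_trans (ler_normB _ _)) // normr1 -natr1 lerD2r.
        by rewrite indicE; case: (_ \in _); rewrite ?mulr1 ?mulr0 ?normr0 ?normr_nat.
      rewrite integral_cst // -[X in (_ * (_ * X))%E]/(out_measure setT).
      by rewrite out_measure_setT -!EFinM ltry.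
    case: negN => S [mS S0 NS]; exists S; split => //; apply: subset_trans NS => p /=.
    apply: contraNP => nN; apply/eqP.
    rewrite /matching_flow; congr (_ * (_ * (_ * _ - _))); rewrite !indicE -MN.
    congr (_%:R); congr nat_of_bool; apply/idP/idP; rewrite !inE; last by left.
    by case.
  - by move=> x y nE; rewrite /matching_flow indicE memNset // mul0r.
  - move=> x y; rewrite /matching_flow.
    have [xy|xy] := pselect (E (x, y)); last first.
      have yx : ~ E (y, x) by move/(limit_edges_sym).
      by rewrite !indicE (memNset xy) (memNset yx) !mul0r oppr0.
    have yx : E (y, x) by apply/(limit_edges_sym).
    rewrite !indicE !(mem_set xy) !(mem_set yx) !mul1r /= (limit_edges_side DP xy).
    rewrite (_ : ((y, x) \in M) = ((x, y) \in M)); last by apply/idP/idP; rewrite !inE; exact: Msym.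
    by case: (side D x); rewrite /= ?expr0 ?expr1; ring.
  move=> x; rewrite sum_neighbours; last first.
    by move=> u v nE; rewrite /matching_flow indicE memNset // mul0r.
  have [y [Mxy uy]] := Mex x.
  have [r0 r0d r0y] := (limit_edgesE x y).1 (ME _ Mxy).
  have MP (r : 'I_d) : \1_M (x, nb r x) = (r == Ordinal r0d)%:R :> R.
    rewrite indicE; congr (_%:R); congr nat_of_bool; apply/idP/eqP => [|->].
      rewrite inE => /uy yr; apply: val_inj => /=.
      by apply: (nb_inj (x := x)); rewrite // r0y.
    by rewrite inE /= r0y.
  have flowE (r : 'I_d) : matching_flow M (x, nb r x) =
      (-1) ^+ side D x * (d%:R * (r == Ordinal r0d)%:R - 1).
    by rewrite /matching_flow MP indicE (mem_set (EE r x (ltn_ord r))) mul1r.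
  under eq_bigr => r _ do rewrite flowE.
  rewrite -mulr_sumr sumrB -mulr_sumr (bigD1 (Ordinal r0d)) //= eqxx big1; last first.
    by move=> r /negbTE ->.
  by rewrite sumr_const card_ord addr0 mulr1 subrr mulr0.
move=> [L1 circ]; have [S [mS S0 sub]] := circulation_negligible L1 circ.
(* Up to sign the flow takes the values [d - 1] and [-1] on edges, both nonzero for [d >= 2]; the
   set of all edges would be null. *)
have ES : E `<=` S.
  move=> p Ep; apply: sub => /=; rewrite /matching_flow !indicE (mem_set Ep) mul1r.
  rewrite mulf_neq0 ?signr_eq0 //; case: (_ \in M) => /=.
    by rewrite mulr1 subr_eq0 -[1]/(1%:R) eqr_nat; case: d d2 => [|[|]].
  by rewrite mulr0 sub0r oppr_eq0 oner_eq0.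
by have := limit_edges_nonnull ES mS S0; case: d d2.
Qed.

End MeasuredGraph.

Unset Implicit Arguments.

Theorem theorem1 (R : realType) (d : nat) (hd : (2 <= d)%N) :
  exists (disp : measure_display) (V : measurableType disp)
         (nu : probability V R) (E : set (V * V)),
    [/\ standard_borel R V,
        treeing nu E,
        regular R d E,
        measurably_bipartite E &
        ~ (exists M : set (V * V), measurable_perfect_matching nu E M) /\
        (forall phi : V * V -> R, L1as nu E phi -> circulation phi ->
           (edge_measure nu E).-negligible [set e | phi e != 0])].
Proof.
have d_gt0 : (0 < d)%N := ltnW hd.
pose D n (x : coord_space R d_gt0) := coordinate n (x : point_space R d_gt0).
have DP : coordinate_system d D := coordinate_systemP R d_gt0.
have D_gen : @measurable _ (coord_space R d_gt0) = <<s cylinders D >> by [].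
have D_prob n c : (c < (width d n).*2)%N ->
    coord_prob R d_gt0 [set x | D n x = c] = ((width d n).*2%:R^-1)%:E.
  exact: coord_probE.
exists _, (coord_space R d_gt0), (coord_prob R d_gt0), (limit_edges d D); split.
- exact: standard_borel_coord_space.
- exact: treeing_limit_edges DP D_gen D_prob.
- exact: regular_limit_edges DP.
- exact: bipartite_limit_edges DP D_gen.
split; first exact: no_perfect_matching DP D_gen D_prob hd.
exact: circulation_negligible DP D_gen D_prob.
Qed.
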